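(* Suppose that for some $\delta>0$, every DeMorgan formula of size $\ell$ has a probabilistic polynomial over $\mathbb{F}_2$ of degree $\ell^{1-\delta}$ with error $1/3$. Then for every $\alpha<\delta/(1-\delta)$ there is $\gamma>0$ such that every DeMorgan formula $F$ on $n$ variables of size $s=O(n^{3+\alpha})$ can be computed by a $\mathrm{SUM}_{2^{n^{1-\gamma}}}\circ\mathrm{MOD2}_{2^{n^{1-\gamma}}}\circ\mathrm{AND}_{n^{1-\gamma}}$ circuit; i.e., there are at most $2^{n^{1-\gamma}}$ polynomials $p_j$ over $\mathbb{F}_2$, each of degree at most $n^{1-\gamma}$ and with at most $2^{n^{1-\gamma}}$ monomials, and real weights $w_j$, such that $\left|\sum_j w_j p_j(x) - F(x)\right|\le 1/3$ for all $x\in\{0,1\}^n$ (where $p_j(x)\in\{0,1\}$ is viewed as a real number).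
   Context: A DeMorgan formula is a tree whose internal nodes are fan-in-2 AND and OR gates and whose leaves are literals $x_i$ or $\neg x_i$; its size is its number of leaves. A probabilistic polynomial for $f\colon\{0,1\}^n\to\{0,1\}$ with degree $d$ and error $\epsilon$ is a distribution $\mathcal{D}$ over $n$-variate polynomials over $\mathbb{F}_2$ of degree at most $d$ such that for every $x\in\{0,1\}^n$, $\Pr_{p\sim\mathcal{D}}[p(x)=f(x)]\ge 1-\epsilon$. A SUM gate computes an approximate sum: a real-weighted sum of its inputs which, on every Boolean input, is within $\pm1/3$ of the 0/1 value of the target function. Subscripts denote fan-in bounds: MOD2 gates compute parity of their inputs, AND gates are conjunctions of input variables. The statement $s=O(n^{3+\alpha})$ is asymptotic in $n$. *)

(* Defs.v *)
From HB Require Import structures.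
From mathcomp Require Import all_boot all_order all_algebra finmap.
From mathcomp Require Import reals exp.
(* the notations of [mpoly] clash with those of [exp] *)
From mathcomp Require Import -(notations) mpoly.

Set Implicit Arguments.
Unset Strict Implicit.
Unset Printing Implicit Defensive.

Import Order.TTheory GRing.Theory Num.Theory.

Local Open Scope ring_scope.

Inductive formula (n : nat) : Type :=
| Lit (i : 'I_n) (positive : bool)
| And (F G : formula n)
| Or (F G : formula n).

Fixpoint fsize (n : nat) (F : formula n) : nat :=
  match F with
  | Lit _ _ => 1%N
  | And F G | Or F G => (fsize F + fsize G)%N
  end.

Notation cube n := {ffun 'I_n -> bool}.

Fixpoint feval (n : nat) (F : formula n) (x : cube n) : bool :=
  match F with
  | Lit i positive => if positive then x i else ~~ x i
  | And F G => feval F x && feval G x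
  | Or F G => feval F x || feval G x
  end.

Notation poly2 n := (mpoly.mpoly n 'F_2).

(* [mpoly.msize] is the total degree plus one, and 0 for the zero polynomial *)
Definition pdeg (n : nat) (p : poly2 n) : nat := (mpoly.msize p).-1.

Definition nmonomials (n : nat) (p : poly2 n) : nat := size (mpoly.msupp p).

(* the value in 'F_2, identified with bool via 0 = false and 1 = true *)
Definition peval (n : nat) (p : poly2 n) (x : cube n) : bool :=
  mpoly.meval (fun i => (x i)%:R) p == 1.

(* There are finitely many polynomials over 'F_2 of bounded degree in n
   variables, so a distribution on them is a finitely supported mass function *)
Definition is_distr (R : realType) (T : choiceType)
    (D : {fsfun T -> R with 0}) : Prop :=
  (forall t, 0 <= D t) /\ \sum_(t <- finsupp D) D t = 1.

Definition prob (R : realType) (T : choiceType)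
    (D : {fsfun T -> R with 0}) (E : pred T) : R :=
  \sum_(t <- finsupp D | E t) D t.

Definition has_prob_poly (R : realType) (n : nat) (f : cube n -> bool)
    (d eps : R) : Prop :=
  exists D : {fsfun poly2 n -> R with 0},
    [/\ is_distr D,
        (forall p, p \in finsupp D -> (pdeg p)%:R <= d) &
        forall x : cube n, prob D [pred p | peval p x == f x] >= 1 - eps].

(* SUM_a o MOD2_b o AND_c circuits: a MOD2_b o AND_c subcircuit is a
   polynomial over 'F_2 of degree at most c with at most b monomials *)
Definition sum_mod2_and (R : realType) (n : nat) (a b c : R)
    (f : cube n -> bool) : Prop :=
  exists (k : nat) (p : 'I_k -> poly2 n) (w : 'I_k -> R),
    [/\ k%:R <= a,
        (forall j, (pdeg (p j))%:R <= c /\ (nmonomials (p j))%:R <= b) &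
        forall x : cube n,
          `| (\sum_(j < k) w j * (peval (p j) x)%:R) - (f x)%:R | <= 1 / 3%:R].

(* Main.v *)
(** Cut [F] into a top formula [G] over [g = O(s / l)] pieces of size [O(l)], with
    [l] slightly larger than [n^(1 + alpha)]. A formula of size [g] has approximate
    degree [O(sqrt g)]: the adversary vectors of a formula multiply up exactly to
    its size, and they give two projections [P] and [Q_y], the second depending
    affinely on the input [y], such that [e_0] is correlated with a common null
    vector of [P] and [Q_y] when [G y] holds, and otherwise is a difference of short
    vectors from their ranges. The Dirichlet kernel evaluated at [1 - P - Q_y]
    separates the two cases. So [G] is approximated by a real combination of few
    parities of at most [n^(1 - 2e)] pieces. Each piece has a probabilistic
    polynomial of degree [O(n^(1 - 2e))]; [O(n)] samples suffice by multiplicative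
    weights, and taking majorities over all [O(log n)]-tuples of samples, with the
    same tuple of indices in all pieces, makes all pieces correct for all but a small
    fraction of the tuples. Averaging over the tuples gives the circuit, since a
    parity of polynomials over ['F_2] is again such a polynomial. *)

From mathcomp Require Import all_boot all_order all_algebra finmap.
From mathcomp Require Import reals exp.
(* the notations of [mpoly] clash with those of [exp] *)
From mathcomp Require Import -(notations) mpoly.
From mathcomp Require Import ring lra zify.
Require Import Defs.
Set Implicit Arguments.
Unset Strict Implicit.
Unset Printing Implicit Defensive.

Import Order.TTheory GRing.Theory Num.Theory.

Local Open Scope ring_scope.

(** * Degree of real functions on the cube *)

Section CubeDegree.
Variables (R : realType) (m : nat).
Implicit Types (S T : {set 'I_m}) (y : cube m) (f g : cube m -> R).

Definition parity S y : bool := \big[addb/false]_(i in S) y i.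

Definition chi S y : R := (-1) ^+ parity S y.

Lemma chi_prod S y : chi S y = \prod_(i in S) (-1) ^+ y i.
Proof.
have f0 : (-1) ^+ false = 1 :> R by [].
by rewrite /chi /parity (big_morph (fun b : bool => (-1) ^+ b) (@signr_addb R) f0).
Qed.

Lemma chi_parity S y : chi S y = 1 - 2 * (parity S y)%:R.
Proof. by rewrite /chi; case: (parity S y) => /=; rewrite ?expr1 ?expr0; ring. Qed.

Lemma chi_set0 y : chi set0 y = 1.
Proof. by rewrite chi_prod big_set0. Qed.

Lemma chi_set1 i y : chi [set i] y = (-1) ^+ y i.
Proof. by rewrite chi_prod big_set1. Qed.

Lemma chiM S T y : chi S y * chi T y = chi ((S :\: T) :|: (T :\: S)) y.
Proof.
rewrite !chi_prod [X in X * _]big_mkcond [X in _ * X]big_mkcond [RHS]big_mkcond.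
rewrite -big_split /=; apply: eq_bigr => i _; rewrite !inE.
case: (i \in S); case: (i \in T); case: (y i); rewrite /= ?expr0 ?expr1; ring.
Qed.

(** Characters replace monomials because a parity of polynomials over ['F_2] keeps their degree.
    Repetitions in the list make sums mere concatenations; [cube_degree_coef] merges them. *)
Definition cube_degree (d : nat) f : Prop :=
  exists s : seq (R * {set 'I_m}),
    all (fun p : R * {set 'I_m} => #|p.2| <= d)%N s /\
    forall y, f y = \sum_(p <- s) p.1 * chi p.2 y.

Lemma cube_degree_ext d f g : f =1 g -> cube_degree d f -> cube_degree d g.
Proof. by move=> fg [s [sd fs]]; exists s; split=> // y; rewrite -fg. Qed.

Lemma cube_degree_le d d' f : (d <= d')%N -> cube_degree d f -> cube_degree d' f.
Proof.
move=> dd [s [sd fs]]; exists s; split=> //.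
by apply: sub_all sd => p /leq_trans; apply.
Qed.

Lemma cube_degree_cst d c : cube_degree d (fun=> c).
Proof.
exists [:: (c, set0)]; split=> [|y]; first by rewrite /= cards0.
by rewrite big_seq1 chi_set0 mulr1.
Qed.

Lemma cube_degree_var i : cube_degree 1 (fun y => (y i)%:R).
Proof.
exists [:: (1 / 2, set0); (- (1 / 2), [set i])].
split=> [|y]; first by rewrite /= cards0 cards1.
rewrite !big_cons big_nil /= chi_set0 chi_set1.
by case: (y i); rewrite /= ?expr0 ?expr1; lra.
Qed.

Lemma cube_degreeD d f g :
  cube_degree d f -> cube_degree d g -> cube_degree d (fun y => f y + g y).
Proof.
move=> [s [sd fs]] [t [td gt]]; exists (s ++ t).
by rewrite all_cat sd td; split=> // y; rewrite big_cat fs gt.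
Qed.

Lemma cube_degreeM d e f g :
  cube_degree d f -> cube_degree e g -> cube_degree (d + e) (fun y => f y * g y).
Proof.
move=> [s [sd fs]] [t [te gt]].
exists [seq (p.1 * q.1, (p.2 :\: q.2) :|: (q.2 :\: p.2)) | p <- s, q <- t].
split=> [|y].
  apply/allP => _ /allpairsP[[p q] [/= ps qt ->]] /=.
  rewrite (leq_trans (leq_card_setU _ _))// leq_add//.
    by rewrite (leq_trans _ (allP sd _ ps))// subset_leq_card// subsetDl.
  by rewrite (leq_trans _ (allP te _ qt))// subset_leq_card// subsetDl.
rewrite big_allpairs_dep fs gt mulr_suml; apply: eq_bigr => p _.
by rewrite mulr_sumr; apply: eq_bigr => q _ /=; rewrite -chiM; ring.
Qed.

Lemma cube_degreeZ d c f : cube_degree d f -> cube_degree d (fun y => c * f y).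
Proof. by move=> /(cube_degreeM (cube_degree_cst 0 c)); rewrite add0n. Qed.

Lemma cube_degree_sum d (I : Type) (r : seq I) (f : I -> cube m -> R) :
  (forall i, cube_degree d (f i)) -> cube_degree d (fun y => \sum_(i <- r) f i y).
Proof.
move=> fd; elim: r => [|i r IH].
  by apply: cube_degree_ext (cube_degree_cst d 0) => y; rewrite big_nil.
by apply: cube_degree_ext (cube_degreeD (fd i) IH) => y; rewrite big_cons.
Qed.

Lemma cube_degree_coef d f : cube_degree d f ->
  exists c : {set 'I_m} -> R,
    forall y, f y = \sum_(S : {set 'I_m} | (#|S| <= d)%N) c S * chi S y.
Proof.
move=> [s [sd fs]]; exists (fun S => \sum_(p <- s | p.2 == S) p.1) => y.
under eq_bigr do rewrite mulr_suml big_mkcond.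
rewrite exchange_big /= fs; apply: eq_big_seq => p ps.
rewrite (bigD1 p.2) ?(allP sd _ ps)//= eqxx big1 ?addr0// => S /andP[_ /negPf].
by rewrite eq_sym => ->.
Qed.

End CubeDegree.

Arguments cube_degree_cst {R m}.
Arguments chi {R m}.

(** * Orthogonal projections *)

Section DotProduct.
Variables (R : realType) (n : nat).
Implicit Types (u v w : 'cV[R]_n) (A : 'M[R]_n).

Definition dotv u v : R := (u^T *m v) 0 0.

Lemma dotvE u v : dotv u v = \sum_i u i 0 * v i 0.
Proof. by rewrite /dotv mxE; apply: eq_bigr => i _; rewrite mxE. Qed.

Lemma dotvC u v : dotv u v = dotv v u.
Proof. by rewrite !dotvE; apply: eq_bigr => i _; rewrite mulrC. Qed.

Lemma dotvDl u v w : dotv (u + v) w = dotv u w + dotv v w.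
Proof. by rewrite /dotv linearD/= mulmxDl mxE. Qed.

Lemma dotvDr u v w : dotv w (u + v) = dotv w u + dotv w v.
Proof. by rewrite /dotv mulmxDr mxE. Qed.

Lemma dotvZl c u w : dotv (c *: u) w = c * dotv u w.
Proof. by rewrite /dotv linearZ/= -scalemxAl mxE. Qed.

Lemma dotvZr c u w : dotv w (c *: u) = c * dotv w u.
Proof. by rewrite /dotv -scalemxAr mxE. Qed.

Lemma dotvNl u w : dotv (- u) w = - dotv u w.
Proof. by rewrite -scaleN1r dotvZl mulN1r. Qed.

Lemma dotvNr u w : dotv w (- u) = - dotv w u.
Proof. by rewrite dotvC dotvNl dotvC. Qed.

Lemma dotv_mulmx A u v : dotv (A *m u) v = dotv u (A^T *m v).
Proof. by rewrite /dotv trmx_mul mulmxA. Qed.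

Lemma dotv_ge0 u : 0 <= dotv u u.
Proof. by rewrite dotvE sumr_ge0// => i _; rewrite -expr2 sqr_ge0. Qed.

Lemma dotv_eq0 u : (dotv u u == 0) = (u == 0).
Proof.
apply/eqP/eqP => [|->]; last by rewrite /dotv mulmx0 mxE.
rewrite dotvE => /eqP; rewrite psumr_eq0 => [/allP u0|i _].
  apply/colP => i; have := u0 i (mem_index_enum _).
  by rewrite mxE mulf_eq0 orbb => /eqP.
by rewrite -expr2 sqr_ge0.
Qed.

Lemma dotv_sqr_le u v : dotv u v ^+ 2 <= dotv u u * dotv v v.
Proof.
have [/eqP v0|v0] := boolP (dotv v v == 0).
  have /eqP -> : v == 0 by rewrite -dotv_eq0 v0.
  by rewrite /dotv !mulmx0 mxE expr0n mulr0.
have vp : 0 < dotv v v by rewrite lt_def v0 dotv_ge0.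
have := dotv_ge0 (dotv v v *: u - dotv u v *: v).
rewrite !(dotvDl, dotvDr, dotvNl, dotvNr, dotvZl, dotvZr) (dotvC v u) => H.
have {}H : 0 <= dotv v v * (dotv u u * dotv v v - dotv u v ^+ 2) by lra.
by rewrite -subr_ge0; rewrite pmulr_rge0 in H.
Qed.

Lemma dotv_le_norms u v s t :
  0 <= s -> 0 <= t -> dotv u u <= s ^+ 2 -> dotv v v <= t ^+ 2 ->
  dotv u v <= s * t.
Proof.
move=> s0 t0 us vt; have st0 : 0 <= s * t by rewrite mulr_ge0.
apply: le_trans (ler_norm _) _.
rewrite -(ler_pXn2r (n := 2)) ?nnegrE// real_normK ?num_real// exprMn.
by apply: le_trans (dotv_sqr_le u v) _; rewrite ler_pM ?dotv_ge0.
Qed.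

Definition orth_proj A := A^T = A /\ A *m A = A.

Lemma orth_projE A v : orth_proj A -> dotv v (A *m v) = dotv (A *m v) (A *m v).
Proof. by move=> [At AA]; rewrite dotv_mulmx At mulmxA AA. Qed.

Lemma orth_proj_le A v : orth_proj A -> dotv v (A *m v) <= dotv v v.
Proof.
move=> Ap; have := dotv_ge0 (v - A *m v).
rewrite !(dotvDl, dotvDr, dotvNl, dotvNr) -(orth_projE v Ap) (dotvC _ v); lra.
Qed.

(* Gram--Schmidt, one vector at a time *)
Lemma exists_orth_proj (s : seq 'cV[R]_n) :
  exists A, [/\ orth_proj A, {in s, forall v, A *m v = v} &
    forall u, {in s, forall v, dotv u v = 0} -> A *m u = 0].
Proof.
elim: s => [|v s [A [[At AA] As A0]]].
  by exists 0; split=> [|//|u _]; rewrite ?mul0mx//; split; rewrite ?mul0mx ?trmx0.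
(* [t] is the part of [v] orthogonal to the range of [A]; unless it vanishes, the rank-one
   projection onto [t] is added to [A]. *)
pose t := v - A *m v.
have At0 : A *m t = 0 by rewrite mulmxBr mulmxA AA subrr.
have [t0|t0] := eqVneq t 0.
  exists A; split=> // [w|u us].
    rewrite inE => /orP[/eqP ->|/As//].
    by apply/esym/eqP; rewrite -subr_eq0 -/t t0.
  by apply: A0 => w ws; apply: us; rewrite inE ws orbT.
have tt : dotv t t != 0 by rewrite dotv_eq0.
have ts w : w \in s -> dotv t w = 0.
  by move=> /As <-; rewrite dotvC dotv_mulmx At At0 dotvC /dotv trmx0 mul0mx mxE.
pose c := (dotv t t)^-1.
have mulC w : (A + c *: (t *m t^T)) *m w = A *m w + (c * dotv t w) *: t.
  rewrite mulmxDl -scalemxAl -mulmxA [t^T *m w]mx11_scalar -/(dotv t w).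
  by rewrite mul_mx_scalar scalerA.
have vt : v = A *m v + t by rewrite /t addrC subrK.
have tv : dotv t v = dotv t t.
  by rewrite {1}vt dotvDr -{1}At -dotv_mulmx At0 /dotv trmx0 mul0mx mxE add0r.
exists (A + c *: (t *m t^T)); split.
- split; first by rewrite linearD linearZ /= trmx_mul trmxK At.
  have AE : A *m (t *m t^T) = 0 by rewrite mulmxA At0 mul0mx.
  have EA : t *m t^T *m A = 0.
    by apply: trmx_inj; rewrite !trmx_mul trmxK At AE trmx0.
  have EE : t *m t^T *m (t *m t^T) = dotv t t *: (t *m t^T).
    rewrite -mulmxA [t^T *m (t *m _)]mulmxA [t^T *m t]mx11_scalar -/(dotv t t).
    by rewrite mul_scalar_mx -scalemxAr.
  move: (t *m t^T) AE EA EE => E AE EA EE.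
  rewrite mulmxDr !mulmxDl AA -!scalemxAr -!scalemxAl AE EA EE.
  by rewrite !scaler0 addr0 add0r [_ *: (dotv t t *: _)]scalerA mulVf ?scale1r.
- move=> w; rewrite inE mulC => /orP[/eqP ->|ws].
    by rewrite tv mulVf// scale1r -vt.
  by rewrite ts// mulr0 scale0r addr0 As.
- move=> u us; have Au : A *m u = 0.
    by apply: A0 => w ws; apply: us; rewrite inE ws orbT.
  rewrite mulC Au add0r.
  have -> : dotv t u = 0; last by rewrite mulr0 scale0r.
  rewrite /t dotvDl dotvNl dotv_mulmx At Au {2}/dotv mulmx0 mxE subr0 dotvC.
  by apply: us; rewrite inE eqxx.
Qed.

End DotProduct.

(** * The Dirichlet kernel of a pair of projections *)

Section Dirichlet.
Variable R : realType.

(* With [X = cos t], the two components of [dirichlet k] are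
   [sin ((k + 1/2) t) / sin (t / 2)] and [cos ((k + 1/2) t) / cos (t / 2)]. *)
Fixpoint dirichlet (k : nat) : {poly R} * {poly R} :=
  if k is k'.+1 then
    let: (D, W) := dirichlet k' in
    ('X * D + (1 + 'X) * W, 'X * W - (1 - 'X) * D)
  else (1, 1).

Lemma dirichletS k : dirichlet k.+1 =
  ('X * (dirichlet k).1 + (1 + 'X) * (dirichlet k).2,
   'X * (dirichlet k).2 - (1 - 'X) * (dirichlet k).1).
Proof. by rewrite /=; case: (dirichlet k). Qed.

(** With [X = cos t] the two terms are [2 sin^2] and [2 cos^2] of [(k + 1/2) t]. *)
Lemma dirichlet_pythagoras k :
  (1 - 'X) * (dirichlet k).1 ^+ 2 + (1 + 'X) * (dirichlet k).2 ^+ 2 = 2.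
Proof.
elim: k => [|k IH]; first by rewrite /=; ring.
by rewrite dirichletS /= -IH; ring.
Qed.

(** With [X = cos t] the increment is [2 cos ((k + 1) t)] and the other term is
    [4 sin^2 ((k + 1) t)]. *)
Lemma dirichlet_increment k :
  ((dirichlet k.+1).1 - (dirichlet k).1) ^+ 2 +
  (1 - 'X ^+ 2) * ((dirichlet k).1 + (dirichlet k).2) ^+ 2 = 4.
Proof.
have -> : (4 : {poly R}) = 2 * 2 by ring.
by rewrite dirichletS /= -{1}(dirichlet_pythagoras k); ring.
Qed.

Lemma dirichlet_at1 k :
  (dirichlet k).1.[1] = (2 * k + 1)%:R /\ (dirichlet k).2.[1] = 1.
Proof.
elim: k => [|k [IH1 IH2]]; first by rewrite /= hornerE.
by rewrite dirichletS /= !hornerE IH1 IH2 natrD natrM; split; ring.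
Qed.

End Dirichlet.

Section SymmetricMatrix.
Variables (R : realType) (n : nat).
Implicit Types (B : 'M[R]_n.+1) (p q : {poly R}) (v : 'cV[R]_n.+1).

Lemma trmx_horner_mx B p : B^T = B -> (horner_mx B p)^T = horner_mx B p.
Proof.
move=> Bt; elim/poly_ind: p => [|p c IH]; first by rewrite rmorph0 trmx0.
rewrite rmorphD rmorphM /= horner_mx_X horner_mx_C linearD /= tr_scalar_mx.
rewrite trmx_mul IH Bt; congr (_ + _).
by have := comm_horner_mx2 B 'X p; rewrite horner_mx_X.
Qed.

Lemma horner_mx_eigen B p v : B *m v = v -> horner_mx B p *m v = p.[1] *: v.
Proof.
move=> Bv; elim/poly_ind: p => [|p c IH].
  by rewrite rmorph0 mul0mx horner0 scale0r.
rewrite rmorphD rmorphM /= horner_mx_X horner_mx_C mulmxDl -mulmxA Bv IH.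
by rewrite mul_scalar_mx !hornerE scalerDl.
Qed.

Lemma dotv_horner_mx B p u v :
  B^T = B -> dotv u (horner_mx B p *m v) = dotv (horner_mx B p *m u) v.
Proof. by move=> Bt; rewrite [RHS]dotv_mulmx trmx_horner_mx. Qed.

Lemma horner_mxM_vec B p q v :
  horner_mx B (p * q) *m v = horner_mx B p *m (horner_mx B q *m v).
Proof. by rewrite rmorphM /= mulmxA. Qed.

End SymmetricMatrix.

(* The two reflections [1 - 2P] and [1 - 2Q] compose to a rotation whose angles
   are encoded by the spectrum of [1 - P - Q]. *)
Section TwoProjections.
Variables (R : realType) (n : nat) (P Q : 'M[R]_n.+1).
Hypotheses (Pproj : orth_proj P) (Qproj : orth_proj Q).
Implicit Types (v : 'cV[R]_n.+1).

Definition proj_pair_mx : 'M[R]_n.+1 := 1 - P - Q.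
Local Notation B := proj_pair_mx.
Local Notation H p := (horner_mx B p).
Local Notation D k := (H (dirichlet R k).1).

Lemma proj_pair_mx_sym : B^T = B.
Proof.
have [[Pt _] [Qt _]] := (Pproj, Qproj).
by rewrite /proj_pair_mx !linearB /= tr_scalar_mx Pt Qt.
Qed.

Lemma proj_pair_mulmx v : B *m v = v - P *m v - Q *m v.
Proof. by rewrite !mulmxBl mul1mx. Qed.

(** By idempotence [1 - B^2 = (P - Q)^2]. This and the next two lemmas take the place of the
    spectral bound [-1 <= B <= 1], without diagonalising [B]. *)
Lemma proj_pair_1Xsqr_psd v : 0 <= dotv v (H (1 - 'X ^+ 2) *m v).
Proof.
have -> : H (1 - 'X ^+ 2) = (P - Q) *m (P - Q).
  have [[_ PP] [_ QQ]] := (Pproj, Qproj).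
  rewrite rmorphB rmorphXn rmorph1 /= horner_mx_X expr2 /proj_pair_mx.
  rewrite -[RHS]/((P - Q) * (P - Q)) !(mulrBr, mulrBl, mulr1, mul1r).
  rewrite -![(P * P)%R]/(P *m P) -![(Q * Q)%R]/(Q *m Q) PP QQ.
  move: (P * Q) (Q * P) => U V.
  by apply/matrixP => i j; rewrite !mxE; ring.
rewrite -mulmxA -[X in X *m _]trmxK -dotv_mulmx.
have -> : (P - Q)^T = P - Q.
  by have [[Pt _] [Qt _]] := (Pproj, Qproj); rewrite linearB /= Pt Qt.
exact: dotv_ge0.
Qed.

Lemma proj_pair_1addX_psd v : 0 <= dotv v (H (1 + 'X) *m v).
Proof.
rewrite rmorphD rmorph1 /= horner_mx_X mulmxDl mul1mx proj_pair_mulmx.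
have := orth_proj_le v Pproj; have := orth_proj_le v Qproj.
rewrite !(dotvDr, dotvNr); lra.
Qed.

Lemma proj_pair_1subX v :
  dotv v (H (1 - 'X) *m v) =
  dotv (P *m v) (P *m v) + dotv (Q *m v) (Q *m v).
Proof.
rewrite rmorphB rmorph1 /= horner_mx_X mulmxBl mul1mx proj_pair_mulmx.
rewrite -!orth_projE// !(dotvDr, dotvNr); lra.
Qed.

(** Turns the kernel identities into inequalities: [p * q ^+ 2] has a nonnegative quadratic form as
    soon as [p] has one. *)
Lemma dotv_sandwich p q v :
  dotv v (H (p * q ^+ 2) *m v) = dotv (H q *m v) (H p *m (H q *m v)).
Proof.
rewrite -horner_mxM_vec -dotv_horner_mx ?proj_pair_mx_sym// -horner_mxM_vec.
by congr (dotv v (H _ *m v)); ring.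
Qed.

(** The squared increment is 4 minus a positive semidefinite term. *)
Lemma dirichlet_increment_norm k v :
  let z := (D k.+1 - D k) *m v in dotv z z <= 4 * dotv v v.
Proof.
set p := (dirichlet R k.+1).1 - (dirichlet R k).1.
have -> : D k.+1 - D k = H p by rewrite rmorphB.
cbv zeta; set z := H p *m v; have -> : dotv z z = dotv v (H (p ^+ 2) *m v).
  by rewrite -[p ^+ 2]mul1r dotv_sandwich rmorph1 mul1mx.
have -> : p ^+ 2 = 4%:R%:P -
    (1 - 'X ^+ 2) * ((dirichlet R k).1 + (dirichlet R k).2) ^+ 2.
  by rewrite -[4%:R%:P]/((4%:R : R)%:P) polyC_natr -(dirichlet_increment R k) addrK.
rewrite rmorphB /= horner_mx_C mulmxBl mul_scalar_mx dotvDr dotvNr dotvZr.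
by rewrite dotv_sandwich lerBlDr lerDl proj_pair_1Xsqr_psd.
Qed.

Lemma dirichlet_norm k v :
  dotv (D k *m v) (D k *m v) <= (2 * k + 1)%:R ^+ 2 * dotv v v.
Proof.
elim: k => [|k IH]; first by rewrite rmorph1 mul1mx expr1n mul1r.
have -> : D k.+1 = D k + (D k.+1 - D k) by rewrite addrC subrK.
rewrite mulmxDl; have := dirichlet_increment_norm k v; cbv zeta.
set x := D k *m v; set z := (_ *m v) => zz.
have v0 := dotv_ge0 v; set s := Num.sqrt (dotv v v).
have s2 : dotv v v = s ^+ 2 by rewrite sqr_sqrtr.
have s0 : 0 <= s by rewrite sqrtr_ge0.
have k0 : 0 <= (2 * k + 1)%:R :> R by [].
have xz : dotv x z <= ((2 * k + 1)%:R * s) * (2 * s).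
  apply: dotv_le_norms; rewrite ?mulr_ge0// exprMn -s2//.
  by apply: le_trans zz _; rewrite ler_wpM2r//; lra.
have -> : (2 * k.+1 + 1)%:R = (2 * k + 1)%:R + 2 :> R.
  by rewrite -[2]/(2%:R) -natrD; congr _%:R; lia.
rewrite !(dotvDl, dotvDr) (dotvC z x) s2; move: IH zz xz; rewrite -/x s2.
move: (2 * k + 1)%:R k0 => c c0; nra.
Qed.

(** Here [B] fixes [v], which is the angle 0, where the kernel peaks. *)
Lemma dirichlet_fixed k v :
  P *m v = 0 -> Q *m v = 0 -> D k *m v = (2 * k + 1)%:R *: v.
Proof.
move=> Pv Qv; rewrite horner_mx_eigen ?(proj1 (dirichlet_at1 R k))//.
by rewrite proj_pair_mulmx Pv Qv !subr0.
Qed.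

(** The bound does not grow with [k]. With [x = D v] and [z = D x], symmetry gives
    [|x|^2 = <a, P z> - <b, Q z>], and the Pythagorean identity gives
    [|P z|^2 + |Q z|^2 <= 2 |x|^2]; Cauchy--Schwarz concludes. *)
Lemma dirichlet_moved k a b v :
  P *m a = a -> Q *m b = b -> v = a - b ->
  dotv (D k *m v) (D k *m v) <= 2 * (dotv a a + dotv b b).
Proof.
move=> Pa Qb vE; set x := D k *m v; pose z := D k *m x.
have [[Pt _] [Qt _]] := (Pproj, Qproj).
have xE : dotv x x = dotv (P *m z) a - dotv (Q *m z) b.
  rewrite {2}/x dotv_horner_mx ?proj_pair_mx_sym// -/z vE dotvDr dotvNr.
  by rewrite !dotv_mulmx Pt Qt Pa Qb.
have zz : dotv (P *m z) (P *m z) + dotv (Q *m z) (Q *m z) <= 2 * dotv x x.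
  rewrite -proj_pair_1subX -dotv_sandwich.
  have -> : (1 - 'X) * (dirichlet R k).1 ^+ 2 =
      (2%:R : R)%:P - (1 + 'X) * (dirichlet R k).2 ^+ 2.
    by rewrite polyC_natr -(dirichlet_pythagoras R k) addrK.
  rewrite rmorphB /= horner_mx_C mulmxBl mul_scalar_mx dotvDr dotvNr dotvZr.
  by rewrite dotv_sandwich lerBlDr lerDl proj_pair_1addX_psd.
have PA := dotv_sqr_le (P *m z) a; have QB := dotv_sqr_le (Q *m z) b.
have x0 := dotv_ge0 x.
have [A0 B0] := (dotv_ge0 (P *m z), dotv_ge0 (Q *m z)).
have [a0 b0] := (dotv_ge0 a, dotv_ge0 b).
set s := dotv a a + dotv b b.
have xx : dotv x x ^+ 2 <= (2 * dotv x x) * s.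
  apply: le_trans (_ : _ <= (dotv (P *m z) (P *m z) + dotv (Q *m z) (Q *m z)) * s) _.
    rewrite xE /s; move: PA QB A0 B0 a0 b0.
    move: (dotv (P *m z) a) (dotv (Q *m z) b) (dotv (P *m z) (P *m z)).
    move: (dotv (Q *m z) (Q *m z)) (dotv a a) (dotv b b) => F a2 b2 p q E.
    move=> pE qF E0 F0 a0 b0.
    (* The cross term of a two-dimensional Cauchy--Schwarz inequality, by comparing arithmetic and
       geometric means. *)
    have cross : - (2 * p * q) <= E * b2 + F * a2.
      have [pq0|pq0] := lerP 0 (- (p * q)); last by nra.
      have h1 : (- (2 * (p * q))) ^+ 2 <= (E * b2 + F * a2) ^+ 2.
        have : (p * q) ^+ 2 <= (E * a2) * (F * b2).
          by rewrite exprMn ler_pM ?sqr_ge0.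
        have := sqr_ge0 (E * b2 - F * a2); lra.
      have : - (2 * (p * q)) <= E * b2 + F * a2; last by lra.
      by rewrite -ler_sqr ?nnegrE ?addr_ge0 ?mulr_ge0//; lra.
    lra.
  by rewrite ler_wpM2r// addr_ge0.
have [x1|] := ltrP 0 (dotv x x); last first.
  by move=> x1; apply: le_trans x1 _; rewrite mulr_ge0 ?addr_ge0.
rewrite -(ler_pM2l x1); lra.
Qed.

End TwoProjections.

(** * Approximate degree of formulas *)

Section Adversary.
Variables (R : realType) (m : nat).

Lemma dotv_col_mx N1 N2 (a c : 'cV[R]_N1) (b d : 'cV[R]_N2) :
  dotv (col_mx a b) (col_mx c d) = dotv a c + dotv b d.
Proof. by rewrite /dotv tr_col_mx mul_row_col mxE. Qed.

Lemma dotv0l N (v : 'cV[R]_N) : dotv 0 v = 0.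
Proof. by rewrite /dotv trmx0 mul0mx mxE. Qed.

Lemma dotv0r N (v : 'cV[R]_N) : dotv v 0 = 0.
Proof. by rewrite dotvC dotv0l. Qed.

(** A span program in vector form: only coordinates whose literal is true at [x] and false at [y]
    contribute to the inner product 1. *)
Definition adversary N (lit : 'I_N -> cube m -> bool) (f : cube m -> bool)
    (r c : R) : Prop :=
  exists u w : cube m -> 'cV[R]_N,
    [/\ (forall y, f y -> dotv (u y) (u y) <= r /\
           forall j, ~~ lit j y -> u y j 0 = 0),
        (forall y, ~~ f y -> dotv (w y) (w y) <= c /\
           forall j, lit j y -> w y j 0 = 0) &
        forall x y, f x -> ~~ f y -> dotv (u x) (w y) = 1].

Lemma adversary_dual N (lit : 'I_N -> cube m -> bool) f r c :
  adversary lit f r c -> adversary (fun j y => ~~ lit j y) (fun y => ~~ f y) c r.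
Proof.
move=> [u [w [uP wP uw]]]; exists w, u; split=> [y /wP[wc w0]|y|x y fx fy].
- by split=> // j; rewrite negbK; apply: w0.
- by rewrite negbK => /uP.
- by rewrite dotvC uw// -[f y]negbK.
Qed.

Lemma adversary_ext N (lit lit' : 'I_N -> cube m -> bool) f f' r c :
  (forall j, lit j =1 lit' j) -> f =1 f' ->
  adversary lit f r c -> adversary lit' f' r c.
Proof.
move=> ll ff [u [w [uP wP uw]]]; exists u, w.
split=> [y|y|x y]; rewrite -!ff; last exact: uw.
  by move=> /uP[ur u0]; split=> // j; rewrite -ll; apply: u0.
by move=> /wP[ur u0]; split=> // j; rewrite -ll; apply: u0.
Qed.

Definition join_ord T N1 N2 (l1 : 'I_N1 -> T) (l2 : 'I_N2 -> T)
    (j : 'I_(N1 + N2)) : T :=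
  match split j with inl a => l1 a | inr b => l2 b end.

(** On a rejected input the vector of one failing conjunct, padded with zeros, suffices; hence [c]
    is kept and only [r] adds up. *)
Lemma adversary_and N1 N2 (l1 : 'I_N1 -> cube m -> bool)
    (l2 : 'I_N2 -> cube m -> bool) f1 f2 r1 r2 c :
  adversary l1 f1 r1 c -> adversary l2 f2 r2 c ->
  adversary (join_ord l1 l2) (fun y => f1 y && f2 y) (r1 + r2) c.
Proof.
move=> [u1 [w1 [u1P w1P uw1]]] [u2 [w2 [u2P w2P uw2]]].
exists (fun y => col_mx (u1 y) (u2 y)).
exists (fun y => if f1 y then col_mx 0 (w2 y) else col_mx (w1 y) 0).
split=> [y /andP[/u1P[h1 z1] /u2P[h2 z2]]|y|x y /andP[f1x f2x]].
- split; first by rewrite dotv_col_mx lerD.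
  by move=> j; rewrite mxE /join_ord; case: (split j) => a; [apply: z1|apply: z2].
- case: ifP => [_ /w2P[h z]|/negbT /w1P[h z] _]; rewrite dotv_col_mx dotv0l.
    split=> [|j]; first by rewrite add0r.
    by rewrite mxE /join_ord; case: (split j) => a; [rewrite mxE|apply: z].
  split=> [|j]; first by rewrite addr0.
  by rewrite mxE /join_ord; case: (split j) => a; [apply: z|rewrite mxE].
- case: ifP => [_ f2y|/negbT f1y _]; rewrite dotv_col_mx dotv0r.
    by rewrite add0r uw2.
  by rewrite addr0 uw1.
Qed.

Lemma adversary_or N1 N2 (l1 : 'I_N1 -> cube m -> bool)
    (l2 : 'I_N2 -> cube m -> bool) f1 f2 r c1 c2 :
  adversary l1 f1 r c1 -> adversary l2 f2 r c2 ->
  adversary (join_ord l1 l2) (fun y => f1 y || f2 y) r (c1 + c2).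
Proof.
move=> /adversary_dual a1 /adversary_dual a2.
apply: adversary_ext (adversary_dual (adversary_and a1 a2)) => [j y|y].
  by rewrite /join_ord; case: (split j) => a; rewrite negbK.
by rewrite /= negb_and !negbK.
Qed.

Lemma fsize_gt0 (G : formula m) : (0 < fsize G)%N.
Proof. by elim: G => //= F hF G hG; rewrite addn_gt0 hF. Qed.

(** At an AND gate [r] is shared out in proportion to the sizes of the subformulas and [c] is passed
    on; at an OR gate the roles are exchanged. Each leaf is left with [r * c = 1]. *)
Lemma formula_adversary (G : formula m) (r c : R) :
  0 < r -> 0 < c -> r * c = (fsize G)%:R ->
  exists lit : 'I_(fsize G) -> cube m -> bool,
    (forall j, cube_degree 1 (fun y => (lit j y)%:R : R)) /\
    adversary lit (feval G) r c.
Proof.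
have half (F F' : formula m) (a b : R) : 0 < a -> 0 < b ->
    a * b = (fsize F + fsize F')%:R ->
    exists a1 a2, [/\ a = a1 + a2, 0 < a1, 0 < a2,
      a1 * b = (fsize F)%:R & a2 * b = (fsize F')%:R].
  move=> a0 b0 abE; exists ((fsize F)%:R / b), ((fsize F')%:R / b).
  rewrite !divr_gt0 ?ltr0n ?fsize_gt0// !divfK ?gt_eqF//; split=> //.
  by rewrite -mulrDl -natrD -abE mulfK ?gt_eqF.
elim: G r c => [i b|F IHF G IHG|F IHF G IHG] r c r0 c0 /= rc.
- exists (fun _ y => if b then y i else ~~ y i); split=> [_|].
    case: b; first exact: cube_degree_var.
    apply: cube_degree_ext (cube_degreeD (cube_degree_cst 1 (1 : R))
      (cube_degreeZ (-1) (cube_degree_var R i))) => y.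
    by case: (y i); rewrite /= ?mulr0 ?addr0 ?mulr1 ?subrr.
  have sq x : dotv (const_mx x : 'cV[R]_1) (const_mx x) = x ^+ 2.
    by rewrite dotvE big_ord1 !mxE.
  exists (fun=> const_mx (Num.sqrt r)), (fun=> const_mx (Num.sqrt c)).
  split=> [y fy|y fy|x y _ _].
  + by rewrite sq (sqr_sqrtr (ltW r0)); split=> // j; rewrite fy.
  + by rewrite sq (sqr_sqrtr (ltW c0)); split=> // j fj; rewrite fj in fy.
  + by rewrite dotvE big_ord1 !mxE -(sqrtrM _ (ltW r0)) rc sqrtr1.
- have [r1 [r2 [-> r10 r20 h1 h2]]] := half F G r c r0 c0 rc.
  have [l1 [d1 a1]] := IHF _ _ r10 c0 h1.
  have [l2 [d2 a2]] := IHG _ _ r20 c0 h2.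
  exists (join_ord l1 l2); split; last exact: adversary_and.
  by move=> j; rewrite /join_ord; case: (split j).
- have [c1 [c2 [-> c10 c20 h1 h2]]] := half F G c r c0 r0 (etrans (mulrC _ _) rc).
  have [l1 [d1 a1]] := IHF _ _ r0 c10 (etrans (mulrC _ _) h1).
  have [l2 [d2 a2]] := IHG _ _ r0 c20 (etrans (mulrC _ _) h2).
  exists (join_ord l1 l2); split; last exact: adversary_or.
  by move=> j; rewrite /join_ord; case: (split j).
Qed.

End Adversary.

Section ApproximateDegree.
Variables (R : realType) (m : nat).

(** Each step of the recursion applies [B y] once. The two components go together because the
    recursion couples them. *)
Lemma cube_degree_dirichlet n (B : cube m -> 'M[R]_n.+1) (v : 'cV[R]_n.+1) k :
  (forall i j, cube_degree 1 (fun y => B y i j)) ->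
  forall i,
    cube_degree k (fun y => (horner_mx (B y) (dirichlet R k).1 *m v) i 0) /\
    cube_degree k (fun y => (horner_mx (B y) (dirichlet R k).2 *m v) i 0).
Proof.
move=> Bd.
have BM d (g : cube m -> 'cV[R]_n.+1) :
    (forall i, cube_degree d (fun y => g y i 0)) ->
    forall i, cube_degree d.+1 (fun y => (B y *m g y) i 0).
  move=> gd i; have := cube_degree_sum (index_enum 'I_n.+1)
    (fun j => cube_degreeM (Bd i j) (gd j)).
  by apply: cube_degree_ext => y; rewrite mxE.
elim: k => [|k IH] i.
  split; apply: cube_degree_ext (cube_degree_cst 0 (v i 0)) => y;
  by rewrite rmorph1 mul1mx.
set p := (dirichlet R k).1 in IH; set q := (dirichlet R k).2 in IH.
have pS d p' : (forall i, cube_degree d (fun y => (horner_mx (B y) p' *m v) i 0)) ->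
    forall i, cube_degree d.+1 (fun y => (horner_mx (B y) ('X * p') *m v) i 0).
  move=> h j; apply: cube_degree_ext (BM _ _ h j) => y.
  by rewrite horner_mxM_vec horner_mx_X.
have pX j := pS _ _ (fun i => (IH i).1) j; have qX j := pS _ _ (fun i => (IH i).2) j.
have p0 j := cube_degree_le (leqnSn k) (IH j).1.
have q0 j := cube_degree_le (leqnSn k) (IH j).2.
rewrite dirichletS /= -/p -/q; split.
  apply: cube_degree_ext (cube_degreeD (pX i) (cube_degreeD (q0 i) (qX i))) => y.
  by rewrite mulrDl mul1r !rmorphD /= !mulmxDl !mxE.
apply: cube_degree_ext (cube_degreeD (qX i)
  (cube_degreeZ (-1) (cube_degreeD (p0 i) (cube_degreeZ (-1) (pX i))))) => y.
rewrite mulrBl mul1r !rmorphB /= !mulmxBl !mxE; ring.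
Qed.

Lemma formula_approximate_degree (G : formula m) (k : nat) :
  (264 * fsize G <= k ^ 2)%N ->
  exists q : cube m -> R,
    cube_degree (2 * k) q /\
    forall y, 0 <= q y <= 1 /\ `|q y - (feval G y)%:R| <= 1 / 16%:R.
Proof.
move=> kG; set N := fsize G; have N0 : (0 < N)%N := fsize_gt0 G.
(* The small share 1/16 goes to the accepted inputs, where the error will be at most
   [r / (1 + r)]. *)
have [|||lit [litd [u [w [uP wP uw]]]]] :=
  @formula_adversary R m G (1 / 16) (16 * N%:R).
- by lra.
- by rewrite mulr_gt0 ?ltr0n.
- by rewrite mulrA divfK ?mul1r// pnatr_eq0.
pose e0 : 'cV[R]_N.+1 := col_mx (1%:M : 'M_1) 0.
pose a y : 'cV[R]_N.+1 := col_mx (1%:M : 'M_1) (w y).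
pose b y : 'cV[R]_N.+1 := col_mx (0 : 'M_1) (w y).
pose psi y : 'cV[R]_N.+1 := col_mx (1%:M : 'M_1) (- u y).
have [P [Pproj Pin Pout]] :=
  exists_orth_proj [seq a y | y <- enum {: cube m} & ~~ feval G y].
(* [Q y] keeps the coordinates whose literal is false at [y] and drops the extra first one. Only
   [Q y] depends on [y]; [P] serves all inputs. *)
pose d y : 'rV[R]_N.+1 := row_mx (0 : 'M_1) (\row_j (~~ lit j y)%:R).
pose Q y := diag_mx (d y).
have dE y i : d y 0 i = match split (i : 'I_(1 + N)) with
    inl _ => 0 | inr j => (~~ lit j y)%:R end.
  by rewrite /d mxE; case: (split _) => j; rewrite mxE.
have dd y i : d y 0 i * d y 0 i = d y 0 i.
  by rewrite dE; case: (split _) => j; rewrite ?mul0r// -natrM mulnb andbb.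
have Qproj y : orth_proj (Q y).
  split; first by rewrite /Q tr_diag_mx.
  by rewrite /Q mulmx_diag; congr diag_mx; apply/rowP => i; rewrite mxE dd.
have Qcol y (s : 'M_1) (t : 'cV[R]_N) :
    Q y *m (col_mx s t : 'cV_N.+1) = col_mx (0 : 'M_1) (\col_j ((~~ lit j y)%:R * t j 0)).
  apply/colP => i; rewrite mul_diag_mx mxE dE !mxE.
  by case: (split _) => j; rewrite !mxE ?mul0r.
have dot1 (s s' : 'M_1) (t t' : 'cV[R]_N) :
    dotv (col_mx s t : 'cV[R]_N.+1) (col_mx s' t') = dotv s s' + dotv t t'.
  exact: (dotv_col_mx s s' t t').
pose B y := proj_pair_mx P (Q y).
pose D y : 'cV[R]_N.+1 := horner_mx (B y) (dirichlet R k).1 *m e0.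
pose c : R := (2 * k + 1)%:R.
have c0 : 0 < c by rewrite ltr0n addn1.
have c2 : 0 < c ^+ 2 by rewrite exprn_gt0.
have one2 : dotv (1%:M : 'M[R]_1) 1%:M = 1 by rewrite dotvE big_ord1 !mxE mulr1.
(* The squared norm of [D y], relative to the peak [c] of the kernel: two factors of degree [k], and
   a value in [[0, 1]] by [dirichlet_norm]. *)
exists (fun y => c ^- 2 * dotv (D y) (D y)); split.
  apply: cube_degreeZ.
  have Bd i j : cube_degree 1 (fun y => B y i j).
    have dd1 : cube_degree 1 (fun y => d y 0 i).
      under boolp.eq_fun do rewrite dE.
      case: (split _) => t; first exact: cube_degree_cst.
      apply: cube_degree_ext (cube_degreeD (cube_degree_cst 1 (1 : R))
        (cube_degreeZ (-1) (litd t))) => y.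
      by case: (lit t y); rewrite /= ?mulr0 ?addr0 ?mulr1 ?subrr.
    apply: cube_degree_ext (cube_degreeD (cube_degree_cst 1 ((1 - P) i j))
      (cube_degreeZ (- (i == j)%:R) dd1)) => y.
    rewrite /B /proj_pair_mx [RHS]mxE; congr (_ + _).
    have -> : (- Q y) i j = - (d y 0 i *+ (i == j)) by rewrite mxE [X in - X = _]mxE.
    by rewrite mulNr mulrC mulr_natr.
  have Dd i := (cube_degree_dirichlet e0 k Bd i).1.
  have := cube_degree_sum (index_enum 'I_N.+1) (fun i => cube_degreeM (Dd i) (Dd i)).
  by rewrite addnn -mul2n; apply: cube_degree_ext => y; rewrite dotvE.
move=> y.
have q01 : 0 <= c ^- 2 * dotv (D y) (D y) <= 1.
  rewrite mulr_ge0 ?dotv_ge0 ?invr_ge0 ?(ltW c2)//= ler_pdivrMl// mulr1.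
  have := dirichlet_norm Pproj (Qproj y) k e0; rewrite -/(B y) -/(D y) -/c.
  by rewrite [dotv e0 e0]dot1 one2 dotv0l addr0 mulr1.
split=> //; case/andP: q01 => q0 q1.
have [Gy|Gy] := boolP (feval G y).
(* Accepted input: [psi y] is a common null vector with first coordinate 1, so [<D e0, psi> = c],
   and Cauchy--Schwarz gives [q * (1 + 1/16) >= 1]. *)
- have [uy u0] := uP _ Gy.
  have Ppsi : P *m psi y = 0.
    apply: Pout => v /mapP[z]; rewrite mem_filter => /andP[Gz _] ->.
    by rewrite [dotv _ _]dot1 one2 dotvNl uw// subrr.
  have Qpsi : Q y *m psi y = 0.
    rewrite Qcol; set t := (X in col_mx _ X); suff -> : t = 0 by apply: (@col_mx0 R 1 N 1).
    apply/colP => j; rewrite !mxE.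
    by have [|/u0 ->] := boolP (lit j y); rewrite ?mul0r// oppr0 mulr0.
  have De : dotv (D y) (psi y) = c.
    rewrite -dotv_horner_mx ?proj_pair_mx_sym// (dirichlet_fixed k Ppsi Qpsi).
    by rewrite dotvZr [dotv e0 _]dot1 one2 dotv0l addr0 mulr1.
  have := dotv_sqr_le (D y) (psi y).
  rewrite De [dotv (psi y) _]dot1 one2 dotvNl dotvNr opprK => h.
  have qE : dotv (D y) (D y) = c ^+ 2 * (c ^- 2 * dotv (D y) (D y)).
    by rewrite mulVKf ?gt_eqF.
  move: q0 q1 h; rewrite {3}qE; set q := c ^- 2 * _ => q0 q1 h.
  have {}h : 1 <= q * (1 + dotv (u y) (u y)).
    by rewrite -(ler_pM2l c2) mulr1 mulrA.
  have := dotv_ge0 (u y) => uu0; rewrite ler_norml /=; apply/andP; split; nra.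
(* Rejected input: [e0] is the difference of [a y] and [b y], whose squared norms add up to at most
   [1 + 32 N]. *)
have [wy w0] := wP _ Gy.
have Pa : P *m a y = a y.
  by apply: Pin; apply: map_f; rewrite mem_filter Gy mem_enum.
have Qb : Q y *m b y = b y.
  rewrite Qcol; set t := (X in col_mx _ X); suff -> : t = w y by [].
  apply/colP => j; rewrite !mxE.
  by have [/w0 ->|] := boolP (lit j y); rewrite ?mulr0 ?mul1r.
have ab : e0 = a y - b y.
  apply/colP => i; rewrite !mxE; case: (split _) => j; rewrite ?mxE ?subr0//.
  by rewrite subrr.
have := dirichlet_moved Pproj (Qproj y) k Pa Qb ab; rewrite -/(B y) -/(D y).
rewrite [dotv (a y) _]dot1 [dotv (b y) _]dot1 one2 dotv0l => h.
rewrite subr0 ger0_norm// ler_pdivrMl//; apply: le_trans h _.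
have N1 : 1 <= N%:R :> R by rewrite ler1n.
(* Origin of 264: [2 * (1 + 32 N) <= 66 N], which is at most [4 k^2 / 16] when [264 N <= k^2]. *)
have kk : 264 * N%:R <= k%:R ^+ 2 :> R by rewrite -natrX -[264]/(264%:R) -natrM ler_nat.
have k0 : 0 <= k%:R :> R by [].
rewrite /c natrD natrM; nra.
Qed.

End ApproximateDegree.

(** * Cutting a formula into pieces *)

Section Decomposition.
Variable n : nat.
Implicit Types (F A B C : formula n) (f : cube n -> bool).

Fixpoint frename m m' (h : 'I_m -> 'I_m') (G : formula m) : formula m' :=
  match G with
  | Lit i b => Lit (h i) b
  | And F G => And (frename h F) (frename h G)
  | Or F G => Or (frename h F) (frename h G)
  end.

Lemma fsize_frename m m' (h : 'I_m -> 'I_m') G : fsize (frename h G) = fsize G.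
Proof. by elim: G => //= F -> G ->. Qed.

Lemma feval_frename m m' (h : 'I_m -> 'I_m') G y :
  feval (frename h G) y = feval G [ffun i => y (h i)].
Proof. by elim: G => [i b|F IHF G IHG|F IHF G IHG] /=; rewrite ?ffunE ?IHF ?IHG. Qed.

(** Since [g] is both the number of pieces and the size of [G], one bound controls the union bound
    over the pieces and the approximate degree of [G]. *)
Definition decomposes (L g : nat) f : Prop :=
  exists (G : formula g) (p : 'I_g -> formula n),
    [/\ fsize G = g, (forall i, fsize (p i) <= L)%N &
        forall x, f x = feval G [ffun i => feval (p i) x]].

Lemma decomposes_ext L g f f' : f =1 f' -> decomposes L g f -> decomposes L g f'.
Proof. by move=> ff [G [p [Gg pL fG]]]; exists G, p; split=> // x; rewrite -ff. Qed.

Lemma decomposes_piece L F : (fsize F <= L)%N -> decomposes L 1 (feval F).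
Proof.
by move=> FL; exists (Lit ord0 true), (fun=> F); split=> // x; rewrite /= ffunE.
Qed.

Lemma decomposes_gate L g1 g2 f1 f2 : decomposes L g1 f1 -> decomposes L g2 f2 ->
  decomposes L (g1 + g2) (fun x => f1 x && f2 x) /\
  decomposes L (g1 + g2) (fun x => f1 x || f2 x).
Proof.
move=> [G1 [p1 [G1g p1L fG1]]] [G2 [p2 [G2g p2L fG2]]].
have pL i : (fsize (join_ord p1 p2 i) <= L)%N by rewrite /join_ord; case: split.
have e1 x : [ffun i => [ffun i => feval (join_ord p1 p2 i) x] (lshift g2 i)] =
    [ffun i => feval (p1 i) x].
  by apply/ffunP => i; rewrite !ffunE /join_ord (unsplitK (inl _)).
have e2 x : [ffun i => [ffun i => feval (join_ord p1 p2 i) x] (rshift g1 i)] =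
    [ffun i => feval (p2 i) x].
  by apply/ffunP => i; rewrite !ffunE /join_ord (unsplitK (inr _)).
split; [exists (And (frename (@lshift g1 g2) G1) (frename (@rshift g1 g2) G2)) |
        exists (Or (frename (@lshift g1 g2) G1) (frename (@rshift g1 g2) G2))];
  exists (join_ord p1 p2); split=> // [|x]; rewrite /= ?fsize_frename ?G1g ?G2g//;
  by rewrite !feval_frename e1 e2 fG1 fG2.
Qed.

(* The part of the formula above the current cut is a monotone context [C[z]],
   which equals [C0 || C1 && z] with [C0 = C[0]] and [C1 = C[1]]; [t] counts the
   leaves absorbed into the context. The last inequality pays for the pieces:
   every cut consumes [l] leaves. *)
Definition open_decomposition (l t : nat) F : Prop :=
  exists g C0 C1 f,
    [/\ (fsize C0 <= t + 2)%N, (fsize C1 <= t + 2)%N,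
        decomposes (2 * l + 2) g f,
        (forall x, feval F x = feval C0 x || (feval C1 x && f x)) &
        (g * l + 2 * t + 4 * l <= 6 * fsize F)%N].

(** [C0] and [C1] become two more pieces, paid for by [2 * l] of the reserve [4 * l]. *)
Lemma open_decomposition_close l t F : (t <= 2 * l)%N -> open_decomposition l t F ->
  exists g, decomposes (2 * l + 2) g (feval F) /\
    (g * l + 2 * t + 2 * l <= 6 * fsize F)%N.
Proof.
move=> tl [g [C0 [C1 [f [C0t C1t fg FE gl]]]]]; exists (1 + (1 + g))%N; split; last lia.
have d0 : decomposes (2 * l + 2) 1 (feval C0) by apply: decomposes_piece; lia.
have d1 : decomposes (2 * l + 2) 1 (feval C1) by apply: decomposes_piece; lia.
have [_ d] := decomposes_gate d0 (decomposes_gate d1 fg).1.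
by apply: decomposes_ext d => x; rewrite FE.
Qed.

Lemma open_decomposition_start l g F :
  decomposes (2 * l + 2) g (feval F) -> (g * l + 4 * l <= 6 * fsize F)%N ->
  open_decomposition l 0 F.
Proof.
move=> dF gl.
(* The identity context has [C0] false and [C1] true. These constants are built from a literal and
   its negation, whence the [+ 2] in the size bounds. *)
have i : 'I_n by clear dF gl; elim: F.
pose b := Lit i true; pose c := Lit i false.
exists g, (And b c), (Or b c), (feval F); split=> //= [x|]; last by lia.
by case: (x i).
Qed.

Lemma open_decomposition_absorb l t A B :
  open_decomposition l t A ->
  open_decomposition l (t + fsize B) (And A B) /\
  open_decomposition l (t + fsize B) (Or A B).
Proof.
move=> [g [C0 [C1 [f [C0t C1t fg FE gl]]]]]; split.
  exists g, (And C0 B), (And C1 B), f; split=> //=; [lia|lia| |lia] => x.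
  by rewrite FE; case: (feval C0 x); case: (feval C1 x); case: (feval B x);
    case: (f x).
exists g, (Or C0 B), C1, f; split=> //=; [lia|lia| |lia] => x.
by rewrite FE; case: (feval C0 x); case: (feval C1 x); case: (feval B x);
    case: (f x).
Qed.

Lemma open_decomposition_ext l t F F' : feval F =1 feval F' -> fsize F = fsize F' ->
  open_decomposition l t F -> open_decomposition l t F'.
Proof.
move=> FF sF [g [C0 [C1 [f [C0t C1t fg FE gl]]]]]; exists g, C0, C1, f.
by split=> // [x|]; rewrite -?FF -?sF.
Qed.

(** A context with [t >= l] is closed and a new one opened: the term [2 * t] restores the reserve
    that closing has used. *)
Lemma open_decomposition_cut l t F : (t < 2 * l)%N -> open_decomposition l t F ->
  exists2 t', (t' < l)%N & open_decomposition l t' F.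
Proof.
move=> tl dF; have [tl'|tl'] := ltnP t l; first by exists t.
have [g [dg gl]] := open_decomposition_close (ltnW tl) dF.
exists 0%N; first lia.
by apply: open_decomposition_start dg _; lia.
Qed.

Lemma small_or_open_decomposition l F : (0 < l)%N ->
  (fsize F < l)%N \/ exists2 t, (t < l)%N & open_decomposition l t F.
Proof.
move=> l0.
(* Two small sides give a small formula or a single piece; a small side is absorbed by an open one;
   two open sides are closed, and the [2 * l] left by each make up the reserve of the new
   context. *)
have gate A B F0 : F0 = And A B \/ F0 = Or A B ->
    ((fsize A < l)%N \/ exists2 t, (t < l)%N & open_decomposition l t A) ->
    ((fsize B < l)%N \/ exists2 t, (t < l)%N & open_decomposition l t B) ->
    (fsize F0 < l)%N \/ exists2 t, (t < l)%N & open_decomposition l t F0.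
  move=> F0E; have sF : fsize F0 = (fsize A + fsize B)%N by case: F0E => ->.
  move=> [Al|[t tl dA]] [Bl|[t' tl' dB]].
  - have [Fl|Fl] := ltnP (fsize F0) l; [by left|right; exists 0%N => //].
    apply: (@open_decomposition_start l 1); last by lia.
    by apply: decomposes_piece; lia.
  - right; apply: (@open_decomposition_cut l (t' + fsize A)); first lia.
    have [d1 d2] := open_decomposition_absorb A dB.
    case: F0E sF => -> sF.
      by apply: open_decomposition_ext d1; rewrite /= 1?addnC// => x; rewrite /= andbC.
    by apply: open_decomposition_ext d2; rewrite /= 1?addnC// => x; rewrite /= orbC.
  - right; apply: (@open_decomposition_cut l (t + fsize B)); first lia.
    by have [d1 d2] := open_decomposition_absorb B dA; case: F0E => ->.
  - right; exists 0%N => //.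
    have [|g [dg gl]] := open_decomposition_close _ dA; first lia.
    have [|g' [dg' gl']] := open_decomposition_close _ dB; first lia.
    have [d1 d2] := decomposes_gate dg dg'.
    apply: (@open_decomposition_start l (g + g')); last by lia.
    by case: F0E => ->; [exact: d1|exact: d2].
elim: F => [i b|A IHA B IHB|A IHA B IHB].
- have [l1|l1] := ltnP 1 l; [by left|right; exists 0%N => //].
  apply: (@open_decomposition_start l 1); last by rewrite /=; lia.
  by apply: decomposes_piece; rewrite /=; lia.
- by apply: gate IHA IHB; left.
- by apply: gate IHA IHB; right.
Qed.

Lemma formula_decomposition l F : (0 < l)%N ->
  exists2 g, (g * l <= 6 * fsize F + l)%N & decomposes (2 * l + 2) g (feval F).
Proof.
move=> l0; have [Fl|[t tl dF]] := small_or_open_decomposition F l0.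
  by exists 1%N; [lia|apply: decomposes_piece; lia].
have [|g [dg gl]] := open_decomposition_close _ dF; first lia.
by exists g => //; lia.
Qed.

End Decomposition.

(** * Sampling a probabilistic polynomial *)

Section Sampling.
Variable R : realType.

Lemma distr_average (T : choiceType) (D : {fsfun T -> R with 0}) (S : T -> R) c :
  is_distr D -> \sum_(t <- finsupp D) D t * S t <= c ->
  exists2 t, t \in finsupp D & S t <= c.
Proof.
move=> [D0 D1] DS; apply/hasP; apply/negPn/negP => /hasPn noS.
have pos t : t \in finsupp D -> 0 < D t * (S t - c).
  move=> tD; rewrite mulr_gt0//; first by rewrite lt_def D0 andbT -mem_finsupp.
  by rewrite subr_gt0 ltNge noS.
have : \sum_(t <- finsupp D) D t * (S t - c) <= 0.
  by under eq_bigr do rewrite mulrBr; rewrite sumrB -mulr_suml D1 mul1r subr_le0.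
rewrite leNgt => /negP; apply.
have [D0'|[t tD]] := fset_0Vmem (finsupp D).
  by move: D1; rewrite D0' big_seq_fset0 => /esym/eqP; rewrite oner_eq0.
rewrite (big_rem t) //=; apply: ltr_wpDr (pos _ tD).
by rewrite big_seq sumr_ge0// => u /mem_rem /pos /ltW.
Qed.

(* Multiplicative weights: every choice of a sample point is made by averaging
   against the weights [(5/4)^(number of errors so far)]. *)
Lemma distr_greedy_sample (T : choiceType) (X : finType) (D : {fsfun T -> R with 0})
    (wrong : T -> X -> bool) (M : nat) :
  is_distr D -> (forall x, prob D [pred t | wrong t x] <= 1 / 3) ->
  exists s : seq T, [/\ size s = M, {subset s <= finsupp D} &
    \sum_x (5 / 4) ^+ count (wrong^~ x) s <= #|X|%:R * (13 / 12) ^+ M :> R].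
Proof.
move=> dD err; elim: M => [|M [s [sM sD sw]]].
  exists [::]; split=> //=; under eq_bigr do rewrite expr0.
  by rewrite expr0 mulr1 sumr_const.
pose wt x : R := (5 / 4) ^+ count (wrong^~ x) s.
have wt0 x : 0 <= wt x by rewrite exprn_ge0//; lra.
have [|t tD tw] := @distr_average _ D (fun t => \sum_x wt x * (wrong t x)%:R)
    (1 / 3 * \sum_x wt x) dD.
  under eq_bigr do rewrite mulr_sumr.
  rewrite exchange_big mulr_sumr /=; apply: ler_sum => x _.
  rewrite mulrC; apply: le_trans (ler_wpM2l (wt0 x) (err x)).
  rewrite /prob mulr_sumr [leRHS]big_mkcond; apply: ler_sum => t _ /=.
  by case: (wrong t x); rewrite ?mulr1 ?mulr0 ?mulr0// mulrC.
exists (t :: s); split=> [|u|]; first by rewrite /= sM.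
  by rewrite inE => /orP[/eqP ->//|/sD].
(* An error on at most a third of the weight multiplies the total by at most
   [1 + 1/4 * 1/3 = 13/12]. *)
have -> : \sum_x (5 / 4) ^+ count (wrong^~ x) (t :: s) =
    \sum_x wt x + 1 / 4 * \sum_x wt x * (wrong t x)%:R :> R.
  rewrite mulr_sumr -big_split /=; apply: eq_bigr => x _; rewrite exprD -/(wt x).
  by case: (wrong t x); rewrite /= ?expr0 ?expr1; lra.
by rewrite exprS; rewrite -/(\sum_x wt x) in sw; lra.
Qed.

(** The fraction [50/125 = 2/5] stays below 1/2, as the majorities require. A point with more errors
    would alone outweigh the bound [2^n * (13/12)^(125 n)] on the total weight. *)
Lemma prob_poly_sample n (f : cube n -> bool) (d : R) : (0 < n)%N ->
  has_prob_poly f d (1 / 3%:R) ->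
  exists P : 'I_(125 * n) -> poly2 n,
    (forall j, (pdeg (P j))%:R <= d) /\
    forall x, (#|[set j | peval (P j) x != f x]| <= 50 * n)%N.
Proof.
move=> n0 [D [dD Dd Df]].
have err x : prob D [pred p | peval p x != f x] <= 1 / 3.
  have := Df x; case: dD => _; rewrite /prob (bigID (fun p => peval p x == f x)) /=.
  set a := \sum_(_ <- _ | _) _; set b := \sum_(_ <- _ | _) _; lra.
have [s [sM sD sw]] :=
  @distr_greedy_sample _ _ D (fun p x => peval p x != f x) (125 * n) dD err.
have sMp (j : 'I_(125 * n)) : (j < size s)%N by rewrite sM.
exists (fun j => nth (0 : poly2 n) s j); split=> [j|x]; first by apply: Dd; apply: sD; rewrite mem_nth.
have -> : #|[set j : 'I_(125 * n) | peval (nth (0 : poly2 n) s j) x != f x]| =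
    count (fun p => peval p x != f x) s.
  rewrite -sum1_card -sum1_count (big_nth (0 : poly2 n)) sM big_mkord.
  by apply: eq_bigl => j; rewrite inE.
rewrite leqNgt; apply/negP => big.
suff : #|{: cube n}|%:R * (13 / 12) ^+ (125 * n) < (5 / 4 : R) ^+ (50 * n).+1.
  rewrite ltNge => /negP; apply; apply: le_trans sw.
  rewrite (bigD1 x) //=; apply: ler_wpDr.
    by rewrite sumr_ge0// => y _; rewrite exprn_ge0//; lra.
  by rewrite ler_weXn2l//; lra.
rewrite card_ffun card_bool card_ord natrX !exprS !exprM -exprMn.
(* This is the 25th power of [p5], combined with [(26/25)^25 >= 2]. *)
have num : (2%:R * (13 / 12) ^+ 125 <= (5 / 4) ^+ 50 :> R).
  have p5 : (13 / 12) ^+ 5 * (26 / 25) <= (5 / 4) ^+ 2 :> R by lra.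
  have q5 : 6 / 5 <= (26 / 25) ^+ 5 :> R by lra.
  have q25 : 2 <= (26 / 25) ^+ 25 :> R.
    rewrite -[25%N]/(5 * 5)%N exprM; apply: (@le_trans _ _ ((6 / 5) ^+ 5)); first lra.
    by rewrite lerXn2r ?nnegrE ?exprn_ge0//; lra.
  rewrite -[125%N]/(5 * 25)%N -[50%N]/(2 * 25)%N !exprM.
  apply: (@le_trans _ _ (((13 / 12) ^+ 5 * (26 / 25)) ^+ 25)).
    by rewrite [leRHS]exprMn [leLHS]mulrC ler_wpM2l// !exprn_ge0//; lra.
  by apply: lerXn2r p5; rewrite ?nnegrE ?mulr_ge0 ?exprn_ge0 ?mulr_ge0 ?invr_ge0.
apply: (@le_lt_trans _ _ (((5 / 4) ^+ 50) ^+ n)).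
  by apply: lerXn2r num; rewrite ?nnegrE ?mulr_ge0 ?exprn_ge0 ?mulr_ge0 ?invr_ge0.
by rewrite ltr_pMl ?exprn_gt0//; lra.
Qed.

End Sampling.

(** * Degree over the field with two elements *)

(** A set of at most [d] elements is the set of values of a [d]-tuple over [option 'I_m], with
    [None] as padding. *)
Lemma card_small_sets m d :
  (#|[set S : {set 'I_m} | #|S| <= d]| <= m.+1 ^ d)%N.
Proof.
have -> : (m.+1 ^ d = #|{: {ffun 'I_d -> option 'I_m}}|)%N.
  by rewrite card_ffun card_option !card_ord.
pose img (h : {ffun 'I_d -> option 'I_m}) := [set i | Some i \in codom h].
rewrite -cardsT; apply: leq_trans (leq_imset_card img _).
apply/subset_leq_card/subsetP => S; rewrite inE => Sd; apply/imsetP.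
exists [ffun j : 'I_d => nth None (map some (enum S)) j] => //.
apply/setP => i; rewrite inE; apply/idP/codomP => [iS|[j]].
  have jS : (index i (enum S) < #|S|)%N by rewrite cardE index_mem mem_enum.
  exists (Ordinal (leq_trans jS Sd)); rewrite ffunE /=.
  by rewrite (nth_map i) -?cardE// nth_index ?mem_enum.
rewrite ffunE; have [js|js] := ltnP j (size (map some (enum S))); last first.
  by rewrite nth_default.
by rewrite size_map in js; rewrite (nth_map i)// => -[->]; rewrite -mem_enum mem_nth.
Qed.

Section F2Degree.
Variable n : nat.
Implicit Types (S T : {set 'I_n}) (x : cube n) (f g : cube n -> bool).

Definition conjunction S x : bool := \big[andb/true]_(i in S) x i.

Lemma conjunctionU S T x :
  conjunction (S :|: T) x = conjunction S x && conjunction T x.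
Proof.
rewrite /conjunction !big_andE; apply/forallP/andP => [h|[/forallP hS /forallP hT] i].
  by split; apply/forallP => i; apply/implyP => iS; apply: (implyP (h i));
    rewrite inE iS ?orbT.
by apply/implyP; rewrite inE => /orP[]; [apply/implyP|apply/implyP].
Qed.

(** Lists of multilinear monomials, whose repetitions cancel in pairs. On the cube [x_i^2 = x_i], so
    products of monomials are unions of sets. *)
Definition f2_degree (d : nat) f : Prop :=
  exists s : seq {set 'I_n},
    all (fun S : {set 'I_n} => #|S| <= d)%N s /\
    forall x, f x = \big[addb/false]_(S <- s) conjunction S x.

Lemma f2_degree_ext d f g : f =1 g -> f2_degree d f -> f2_degree d g.
Proof. by move=> fg [s [sd fs]]; exists s; split=> // x; rewrite -fg. Qed.

Lemma f2_degree_cst d b : f2_degree d (fun=> b).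
Proof.
case: b; last by exists [::]; split=> // x; rewrite big_nil.
exists [:: set0]; split=> [|x]; first by rewrite /= cards0.
by rewrite big_seq1 /conjunction big_set0.
Qed.

Lemma f2_degree_addb d f g :
  f2_degree d f -> f2_degree d g -> f2_degree d (fun x => f x (+) g x).
Proof.
move=> [s [sd fs]] [t [td gt]]; exists (s ++ t).
by rewrite all_cat sd td; split=> // x; rewrite big_cat fs gt.
Qed.

Lemma f2_degree_andb d e f g :
  f2_degree d f -> f2_degree e g -> f2_degree (d + e) (fun x => f x && g x).
Proof.
move=> [s [sd fs]] [t [te gt]]; exists [seq U :|: V | U <- s, V <- t].
split=> [|x].
  apply/allP => _ /allpairsP[[S T] [/= Ss Tt ->]].
  rewrite (leq_trans (leq_card_setU _ _))// leq_add//.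
    exact: (allP sd _ Ss).
  exact: (allP te _ Tt).
rewrite big_allpairs_dep fs gt big_distrl /=; apply: eq_bigr => S _.
by rewrite big_distrr /=; apply: eq_bigr => T _; rewrite conjunctionU.
Qed.

Lemma f2_degree_sum d (I : Type) (r : seq I) (P : pred I) (f : I -> cube n -> bool) :
  (forall i, f2_degree d (f i)) ->
  f2_degree d (fun x => \big[addb/false]_(i <- r | P i) f i x).
Proof.
move=> fd; elim: r => [|i r IH].
  by apply: f2_degree_ext (f2_degree_cst d false) => x; rewrite big_nil.
have [Pi|/negPf Pi] := boolP (P i).
  by apply: f2_degree_ext (f2_degree_addb (fd i) IH) => x; rewrite big_cons Pi.
by apply: f2_degree_ext IH => x; rewrite big_cons Pi.
Qed.

Lemma f2_degree_prod d (I : Type) (r : seq I) (f : I -> cube n -> bool) :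
  (forall i, f2_degree d (f i)) ->
  f2_degree (size r * d) (fun x => \big[andb/true]_(i <- r) f i x).
Proof.
move=> fd; elim: r => [|i r IH].
  by apply: f2_degree_ext (f2_degree_cst _ true) => x; rewrite big_nil.
by apply: f2_degree_ext (f2_degree_andb (fd i) IH) => x; rewrite big_cons.
Qed.

(** [h] is the XOR of the indicators of the points where it holds, and each indicator is a product
    of [k] factors of degree [d]. *)
Lemma f2_degree_boolfun d k (h : cube k -> bool) (z : 'I_k -> cube n -> bool) :
  (forall i, f2_degree d (z i)) ->
  f2_degree (k * d) (fun x => h [ffun i => z i x]).
Proof.
move=> zd; have za (a : cube k) :
    f2_degree (k * d) (fun x => \big[andb/true]_i (z i x (+) ~~ a i)).
  have := @f2_degree_prod d _ (index_enum 'I_k) (fun i x => z i x (+) ~~ a i).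
  rewrite /index_enum -enumT size_enum_ord; apply => i.
  exact: f2_degree_addb (zd i) (f2_degree_cst d _).
apply: f2_degree_ext (f2_degree_sum (index_enum {: cube k}) h za) => x.
set zx := [ffun i => z i x].
have eqa (a : cube k) : \big[andb/true]_i (z i x (+) ~~ a i) = (a == zx).
  rewrite big_andE; apply/forallP/eqP => [h'|-> i].
    apply/ffunP => i; rewrite ffunE; have /= := h' i.
    by case: (z i x); case: (a i).
  by rewrite ffunE /=; case: (z i x).
under eq_bigr do rewrite eqa.
have [hz|hz] := boolP (h zx).
  by rewrite (bigD1 zx)//= eqxx big1// => a /andP[_ /negPf].
by rewrite big1// => a ha; apply: contraNF hz => /eqP <-.
Qed.

Lemma F2_addb (a b : 'F_2) : (a + b == 1) = (a == 1) (+) (b == 1).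
Proof. by case: a => [[|[|]]]//= ?; case: b => [[|[|]]]. Qed.

Lemma F2_andb (a b : 'F_2) : (a * b == 1) = (a == 1) && (b == 1).
Proof. by case: a => [[|[|]]]//= ?; case: b => [[|[|]]]. Qed.

Lemma F2_eq01 : ((0 : 'F_2) == 1) = false.
Proof. by []. Qed.

Lemma F2_neq0 (a : 'F_2) : (a != 0) = (a == 1).
Proof. by case: a => [[|[|]]]. Qed.

Lemma F2_monomial x (m : 'I_n -> nat) :
  (\prod_i (x i)%:R ^+ m i == 1 :> 'F_2) = conjunction [set i | m i != 0%N] x.
Proof.
rewrite (big_morph (fun a : 'F_2 => a == 1) F2_andb (eqxx _)).
rewrite /conjunction [RHS]big_mkcond; apply: eq_bigr => i _; rewrite inE.
case: (m i) => [|k]; first by rewrite expr0 eqxx.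
by case: (x i); rewrite /= ?expr1n// expr0n.
Qed.

Lemma f2_degree_peval d (p : poly2 n) : (pdeg p <= d)%N -> f2_degree d (peval p).
Proof.
move=> pd; exists [seq [set i | m i != 0%N] | m : multinom n <- msupp p].
split=> [|x].
  apply/allP => _ /mapP[m mp ->]; apply: leq_trans pd.
  rewrite /pdeg -ltnS (leq_trans _ (leqSpred _))//.
  apply: leq_ltn_trans (msize_mdeg_lt mp); rewrite mdegE -sum1_card big_mkcond /=.
  by apply: leq_sum => i _; rewrite inE; case: (m i).
rewrite big_map /peval mevalE.
rewrite (big_morph (fun a : 'F_2 => a == 1) F2_addb F2_eq01).
apply: eq_big_seq => m; rewrite mcoeff_msupp F2_neq0 => mp.
by rewrite F2_andb mp F2_monomial.
Qed.

Definition set_monomial S : multinom n := Multinom [tuple nat_of_bool (i \in S) | i < n].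

Lemma set_monomialE S i : set_monomial S i = (i \in S).
Proof. by rewrite multinomE tnth_mktuple. Qed.

(** However long the list is, the monomials that survive correspond to distinct sets of at most [d]
    variables. *)
Lemma f2_degree_poly d f : f2_degree d f ->
  exists p : poly2 n, [/\ (pdeg p <= d)%N, (nmonomials p <= n.+1 ^ d)%N &
    peval p =1 f].
Proof.
move=> [s [sd fs]].
pose p : poly2 n := \sum_(S <- s) mpolyX 'F_2 (set_monomial S).
have psupp : {subset msupp p <= map set_monomial s}.
  rewrite /p; elim: s {sd fs p} => [|S s IH] m; first by rewrite big_nil msupp0.
  rewrite big_cons => /msuppD_le; rewrite mem_cat msuppX !inE.
  by case/orP => [->//|/IH ->]; rewrite orbT.
have mdegS S : mdeg (set_monomial S) = #|S|.
  rewrite mdegE -sum1_card [RHS]big_mkcond; apply: eq_bigr => i _.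
  by rewrite set_monomialE; case: (i \in S).
exists p; split.
- rewrite /pdeg -subn1 leq_subLR add1n msizeE; apply/bigmax_leqP_seq => m mp _.
  by have /mapP[S Ss ->] := psupp _ mp; rewrite mdegS ltnS (allP sd _ Ss).
- apply: leq_trans (card_small_sets n d); rewrite /nmonomials cardE.
  rewrite -(size_map set_monomial); apply: uniq_leq_size (msupp_uniq p) _ => m mp.
  have /mapP[S Ss ->] := psupp _ mp; apply: map_f.
  by rewrite mem_enum inE (allP sd _ Ss).
- move=> x; rewrite fs /peval /p raddf_sum /=.
  rewrite (big_morph (fun a : 'F_2 => a == 1) F2_addb F2_eq01).
  apply: eq_bigr => S _; rewrite mevalX F2_monomial; congr conjunction.
  by apply/setP => i; rewrite inE set_monomialE; case: (i \in S).
Qed.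

End F2Degree.

(** * Majorities and composition *)

Section Majority.
Variables (R : realType) (r : nat).

(** A tie counts as false; a wrong outcome of either kind takes at least [r] wrong votes. *)
Definition majority (z : cube (2 * r)) : bool := (r < #|[set i | z i]|)%N.

Lemma majority_wrong (z : cube (2 * r)) b :
  majority z != b -> (r <= #|[set i | z i != b]|)%N.
Proof.
have : (#|[set i | z i]| + #|~: [set i | z i]| = 2 * r)%N by rewrite cardsC card_ord.
rewrite /majority; case: b => sz; last first.
  rewrite eqbF_neg negbK => /ltnW h; apply: leq_trans h _.
  by apply/eq_leq/eq_card => i; rewrite !inE; case: (z i).
rewrite eqb_id -leqNgt => h.
have -> : [set i | z i != true] = ~: [set i | z i].
  by apply/setP => i; rewrite !inE; case: (z i).
lia.
Qed.

(* Exponential moment bound with base [3/2], as in Chernoff's inequality *)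
Lemma card_mostly_wrong M (wrong : pred 'I_M) :
  (5 * #|[set j | wrong j]| <= 2 * M)%N ->
  #|[set t : {ffun 'I_(2 * r) -> 'I_M} | (r <= #|[set l | wrong (t l)]|)%N]|%:R
    <= (24 / 25) ^+ r * M%:R ^+ (2 * r) :> R.
Proof.
move=> wM; set A := [set t | _].
pose F j : R := if wrong j then 3 / 2 else 1.
have FE (t : {ffun 'I_(2 * r) -> 'I_M}) :
    \prod_l F (t l) = (3 / 2) ^+ #|[set l | wrong (t l)]|.
  by rewrite /F -big_mkcond /= prodr_const; congr (_ ^+ _); apply: eq_card => l; rewrite inE.
have F0 (t : {ffun 'I_(2 * r) -> 'I_M}) : 0 <= \prod_l F (t l).
  by rewrite FE exprn_ge0//; lra.
have h1 : #|A|%:R * (3 / 2) ^+ r <=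
    \sum_(t : {ffun 'I_(2 * r) -> 'I_M}) \prod_l F (t l).
  rewrite mulr_natl -sumr_const [leRHS](bigID (mem A)) /=.
  rewrite -[leLHS]addr0 lerD ?sumr_ge0//; apply: ler_sum => t; rewrite inE FE => rt.
  by rewrite ler_weXn2l//; lra.
(* The mean of [F] is at most [1 + 1/2 * 2/5 = 6/5], and [(6/5)^2 / (3/2) = 24/25]. *)
have h2 : \sum_j F j <= 6 / 5 * M%:R.
  have -> : \sum_j F j = M%:R + #|[set j | wrong j]|%:R / 2.
    have -> : M%:R = \sum_(j < M) 1 :> R by rewrite sumr_const card_ord.
    rewrite -sum1_card natr_sum mulr_suml [X in _ + X]big_mkcond -big_split /=.
    by apply: eq_bigr => j _; rewrite inE /F; case: (wrong j); lra.
  have : (5 * #|[set j | wrong j]|)%:R <= (2 * M)%:R :> R by rewrite ler_nat.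
  rewrite !natrM; lra.
have sumE : \sum_(t : {ffun 'I_(2 * r) -> 'I_M}) \prod_l F (t l) =
    (\sum_j F j) ^+ (2 * r).
  by rewrite -(bigA_distr_bigA (fun=> F)) prodr_const card_ord.
rewrite sumE in h1.
have F1 : 0 <= \sum_j F j.
  by rewrite sumr_ge0// => j _; rewrite /F; case: ifP => _; lra.
have p0 : 0 < (3 / 2) ^+ r :> R by rewrite exprn_gt0//; lra.
rewrite -(ler_pM2r p0); apply: le_trans h1 _.
apply: le_trans (_ : _ <= (6 / 5 * M%:R) ^+ (2 * r)) _.
  by apply: lerXn2r h2; rewrite nnegrE// mulr_ge0//; lra.
rewrite exprMn exprM mulrAC -exprMn ler_wpM2r ?exprn_ge0//.
by apply: lerXn2r; rewrite ?nnegrE; lra.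
Qed.

End Majority.

Lemma sum_mod2_and_fin (R : realType) n (a b c : R) (f : cube n -> bool)
    (I : finType) (p : I -> poly2 n) (w : I -> R) :
  #|I|%:R <= a ->
  (forall j, (pdeg (p j))%:R <= c /\ (nmonomials (p j))%:R <= b) ->
  (forall x, `|(\sum_j w j * (peval (p j) x)%:R) - (f x)%:R| <= 1 / 3%:R) ->
  sum_mod2_and a b c f.
Proof.
move=> Ia pb wf; exists #|I|, (fun j => p (enum_val j)), (fun j => w (enum_val j)).
split=> // x; apply: le_trans (wf x); rewrite -(big_enum_val (A := I)
  (fun j => w j * (peval (p j) x)%:R)); exact: lexx.
Qed.

(** * Averaging over the tuples of samples *)

Section Composition.
Variables (R : realType) (n g M r k d : nat) (G : formula g).
Variables (f : 'I_g -> cube n -> bool) (P : 'I_g -> 'I_M -> poly2 n).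
Hypothesis M_gt0 : (0 < M)%N.
Hypothesis G_size : (264 * fsize G <= k ^ 2)%N.
Hypothesis P_deg : forall i j, (pdeg (P i j) <= d)%N.
Hypothesis P_wrong : forall i x,
  (5 * #|[set j | peval (P i j) x != f i x]| <= 2 * M)%N.
Hypothesis r_large : g%:R * (24 / 25) ^+ r <= 1 / 16 :> R.

Local Notation tuples := {ffun 'I_(2 * r) -> 'I_M}.

(** One tuple serves all pieces, so the average has [M^(2 r)] terms whatever [g] is; a union bound
    over the pieces needs no independence. *)
Definition vote (t : tuples) (x : cube n) : cube g :=
  [ffun i => majority [ffun l => peval (P i (t l)) x]].

Lemma f2_degree_vote_parity t S :
  f2_degree (2 * r * d) (fun x => parity S (vote t x)).
Proof.
have vd i : f2_degree (2 * r * d)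
    (fun x => majority [ffun l => peval (P i (t l)) x]).
  by apply: f2_degree_boolfun => l; apply: f2_degree_peval.
apply: f2_degree_ext (f2_degree_sum (index_enum 'I_g) (mem S) vd) => x.
by apply: eq_bigr => i _; rewrite ffunE.
Qed.

Lemma card_vote_wrong x :
  #|[set t | vote t x != [ffun i => f i x]]|%:R
    <= 1 / 16 * M%:R ^+ (2 * r) :> R.
Proof.
pose bad i := [set t : tuples |
  (r <= #|[set l | [pred j | peval (P i j) x != f i x] (t l)]|)%N].
have sub : [set t | vote t x != [ffun i => f i x]] \subset \bigcup_i bad i.
  apply/subsetP => t; rewrite inE => tx; apply/bigcupP.
  have /existsP[i ti] : [exists i, vote t x i != f i x].
    rewrite -negb_forall; apply: contra tx => /forallP h; apply/eqP/ffunP => i.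
    by rewrite [RHS]ffunE; apply/eqP/h.
  exists i => //; rewrite inE; rewrite ffunE in ti.
  apply: leq_trans (majority_wrong ti) _.
  by apply/eq_leq/eq_card => l; rewrite !inE ffunE.
apply: le_trans (_ : _ <= \sum_(i < g) #|bad i|%:R) _.
  rewrite -natr_sum ler_nat; apply: leq_trans (subset_leq_card sub) _.
  elim/big_rec2: _ => [|i B s _ IH]; first by rewrite cards0.
  by rewrite (leq_trans (leq_card_setU _ _))// leq_add2l.
apply: le_trans (_ : _ <= \sum_(i < g) (24 / 25) ^+ r * M%:R ^+ (2 * r)) _.
  by apply: ler_sum => i _; apply: card_mostly_wrong; apply: P_wrong.
rewrite sumr_const card_ord -[leLHS]mulr_natl mulrA.
by rewrite ler_wpM2r// exprn_ge0.
Qed.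

Lemma composed_circuit (a b c : R) :
  (1 + M ^ (2 * r) * g.+1 ^ (2 * k))%:R <= a ->
  (n.+1 ^ (2 * r * d))%:R <= b -> (2 * r * d)%:R <= c ->
  sum_mod2_and a b c (fun x => feval G [ffun i => f i x]).
Proof.
move=> ha hb hc.
have [q [qd qP]] := formula_approximate_degree R G_size.
have [cf qE] := cube_degree_coef qd.
pose A := [set S : {set 'I_g} | (#|S| <= 2 * k)%N].
have [pp ppP] : exists pp : tuples * 'I_#|A| -> poly2 n, forall u,
    [/\ (pdeg (pp u) <= 2 * r * d)%N,
        (nmonomials (pp u) <= n.+1 ^ (2 * r * d))%N &
        peval (pp u) =1 fun x => parity (enum_val u.2) (vote u.1 x)].
  apply: (@fin_all_exists _ (fun=> poly2 n) (fun u p =>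
    [/\ (pdeg p <= 2 * r * d)%N, (nmonomials p <= n.+1 ^ (2 * r * d))%N &
        peval p =1 fun x => parity (enum_val u.2) (vote u.1 x)])) => u.
  exact/f2_degree_poly/f2_degree_vote_parity.
(* As [chi = 1 - 2 * parity], the constant parts of all characters are gathered in the weight of the
   polynomial 1, which is the summand 1 in the size bound. *)
have [p1 [p1d p1m p1E]] := f2_degree_poly (@f2_degree_cst n (2 * r * d) true).
pose N : R := M%:R ^+ (2 * r).
have N0 : 0 < N by rewrite exprn_gt0// ltr0n.
have cardT : \sum_(t : tuples) 1 = N.
  by rewrite sumr_const card_ffun !card_ord /N natrX.
pose wt (S : {set 'I_g}) := N^-1 * cf S.
pose I := (unit + tuples * 'I_#|A|)%type.
apply: (@sum_mod2_and_fin R n a b c _ I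
  (fun j => match j with inl _ => p1 | inr u => pp u end)
  (fun j => match j with
            | inl _ => \sum_(t : tuples) \sum_(S in A) wt S
            | inr u => - (2 * wt (enum_val u.2))
            end)).
- apply: le_trans ha; rewrite ler_nat card_sum card_unit card_prod card_ffun !card_ord.
  by rewrite leq_add2l leq_mul2l card_small_sets orbT.
- move=> [_|u]; last have [h1 h2 _] := ppP u.
    by split; [apply: le_trans hc|apply: le_trans hb]; rewrite ler_nat.
  by split; [apply: le_trans hc|apply: le_trans hb]; rewrite ler_nat.
move=> x; rewrite big_sumType /= big_const card_unit /= addr0 p1E mulr1.
have -> : \sum_(u : tuples * 'I_#|A|) - (2 * wt (enum_val u.2)) * (peval (pp u) x)%:R =
    \sum_(t : tuples) \sum_(S in A) - (2 * wt S) * (parity S (vote t x))%:R.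
  transitivity (\sum_(t : tuples) \sum_(u < #|A|)
      - (2 * wt (enum_val u)) * (peval (pp (t, u)) x)%:R).
    by rewrite pair_bigA; apply: eq_bigr => -[].
  apply: eq_bigr => t _; rewrite [RHS]big_enum_val; apply: eq_bigr => u _.
  by have [_ _ ->] := ppP (t, u).
rewrite -big_split /=.
have -> : \sum_(t : tuples) (\sum_(S in A) wt S +
      \sum_(S in A) - (2 * wt S) * (parity S (vote t x))%:R) =
    N^-1 * \sum_(t : tuples) q (vote t x).
  rewrite mulr_sumr; apply: eq_bigr => t _; rewrite -big_split /= qE mulr_sumr.
  apply: eq_big => [S|S _]; first by rewrite inE.
  by rewrite chi_parity /wt; ring.
set y := [ffun i => f i x].
have -> : N^-1 * \sum_t q (vote t x) - (feval G y)%:R =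
    N^-1 * \sum_t (q (vote t x) - (feval G y)%:R).
  rewrite sumrB mulrBr; congr (_ - _).
  have -> : \sum_(t : tuples) (feval G y)%:R = N * (feval G y)%:R :> R.
    by rewrite -cardT mulr_suml; apply: eq_bigr => t _; rewrite mul1r.
  by rewrite mulKf ?gt_eqF.
rewrite normrM ger0_norm ?invr_ge0 ?(ltW N0)// ler_pdivrMl//.
apply: le_trans (ler_norm_sum _ _ _) _.
(* Since [q] lies in [[0, 1]], a wrong tuple costs at most 1. Such tuples are at most 1/16 of all,
   so the total error is at most 1/8. *)
apply: le_trans (_ : _ <= \sum_(t : tuples) (1 / 16 + (vote t x != y)%:R)) _.
  apply: ler_sum => t _; have [q01 qG] := qP (vote t x).
  have [<-|_] := eqVneq (vote t x) y; first by rewrite addr0.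
  rewrite ler_norml; case/andP: q01 => q0 q1.
  by case: (feval G y); apply/andP; split; rewrite /=; lra.
rewrite big_split /=.
have := card_vote_wrong x; rewrite -/y -/N -sum1_card natr_sum big_mkcond /=.
under eq_bigr do rewrite inE.
have -> : \sum_t (if vote t x != y then 1 else 0) = \sum_t (vote t x != y)%:R :> R.
  by apply: eq_bigr => t _; case: (vote t x != y).
have -> : \sum_(t : tuples) 1 / 16 = N / 16 :> R.
  by rewrite -mulr_suml cardT.
by move=> h; lra.
Qed.

End Composition.

(** * Asymptotics *)

Section Asymptotics.
Variable R : realType.

Lemma powR_add (x a b : R) : 0 < x -> x `^ (a + b) = x `^ a * x `^ b.
Proof. by move=> x0; apply: powRD; apply/implyP => _; rewrite gt_eqF. Qed.

Lemma powR_ge1 (x a : R) : 1 <= x -> 0 <= a -> 1 <= x `^ a.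
Proof. by move=> x1 a0; rewrite -(powRr0 x) ler_powR. Qed.

Lemma powR_eventually_ge (K e : R) : 0 < e ->
  exists n0 : nat, forall n : nat, (n0 <= n)%N -> K <= n%:R `^ e.
Proof.
move=> e0; exists (Num.truncn (`|K| `^ e^-1)).+1 => n nn.
have Kn : `|K| `^ e^-1 <= n%:R.
  have /andP[_ /ltW h] := truncn_itv (powR_ge0 `|K| e^-1).
  by apply: le_trans h _; rewrite ler_nat.
apply: le_trans (ler_norm K) _.
have -> : `|K| = (`|K| `^ e^-1) `^ e.
  by rewrite -powRrM mulVf ?gt_eqF// powRr1.
by apply: ge0_ler_powR Kn; rewrite ?nnegrE ?powR_ge0 ?(ltW e0).
Qed.

Lemma bernoulli (b : R) j : 0 <= b -> 1 + j%:R * b <= (1 + b) ^+ j.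
Proof.
move=> b0; elim: j => [|j IH]; first by rewrite expr0 mul0r addr0.
rewrite exprS mulrSr; apply: (@le_trans _ _ ((1 + b) * (1 + j%:R * b))).
  have : 0 <= j%:R * b * b by rewrite !mulr_ge0.
  by lra.
by rewrite ler_wpM2l//; lra.
Qed.

(** Bernoulli's inequality for [2^c = 1 + b] turns [2^(L - 1) <= n] into [L <= A * n^c]; squaring
    uses [n^(2 c)], and the remaining [n^c] absorbs the constants. *)
Lemma up_log2_eventually_le (K e : R) : 0 < e ->
  exists n0 : nat, forall n : nat, (n0 <= n)%N ->
    K * (up_log 2 n)%:R ^+ 2 <= n%:R `^ e.
Proof.
move=> e0; pose c := e / 3; have c0 : 0 < c by rewrite /c; lra.
pose b : R := 2 `^ c - 1.
have b0 : 0 < b.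
  have : 1 `^ c < 2 `^ c by apply: gt0_ltr_powR; rewrite ?nnegrE//; lra.
  by rewrite powR1 subr_gt0.
pose A := 1 + b^-1.
have [n1 n1P] := powR_eventually_ge (`|K| * A ^+ 2) c0.
exists (maxn n1 2) => n; rewrite geq_max => /andP[/n1P nK n2].
have n0 : 0 < n%:R :> R by rewrite ltr0n; lia.
have n1' : 1 <= n%:R :> R by rewrite ler1n; lia.
set L := up_log 2 n; set y := n%:R `^ c in nK *.
have y1 : 1 <= y by rewrite powR_ge1// ltW.
have LA : L%:R <= A * y.
  have h : (2 `^ c) ^+ L.-1 <= y.
    rewrite -powR_mulrn ?powR_ge0// powRAC powR_mulrn// /y.
    apply: ge0_ler_powR; rewrite ?nnegrE ?(ltW c0) ?exprn_ge0//.
    by rewrite -natrX ler_nat ltnW// up_log_gtn.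
  have -> : L%:R = 1 + L.-1%:R :> R.
    by rewrite -[1]/(1%:R) -natrD add1n prednK// /L up_log_gt0.
  have := bernoulli L.-1 (ltW b0).
  have -> : 1 + b = 2 `^ c by rewrite /b; lra.
  move=> /le_trans /(_ h) h'.
  have {}h' : L.-1%:R <= b^-1 * y by rewrite ler_pdivlMl//; lra.
  by rewrite /A; lra.
have -> : n%:R `^ e = y * y ^+ 2.
  rewrite -exprS -powR_mulrn ?powR_ge0// /y -powRrM; congr (_ `^ _).
  by rewrite /c -[3%:R]/(3 : R); lra.
apply: (@le_trans _ _ (`|K| * (A * y) ^+ 2)).
  apply: (@le_trans _ _ (`|K| * L%:R ^+ 2)).
    by rewrite ler_wpM2r ?sqr_ge0 ?ler_norm.
  rewrite ler_wpM2l// lerXn2r// nnegrE// (le_trans _ LA)//.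
by rewrite exprMn mulrA ler_wpM2r ?sqr_ge0.
Qed.

Lemma natr_le_powR2 (x E : nat) (y : R) :
  (x <= 2 ^ E)%N -> E%:R <= y -> x%:R <= 2%:R `^ y.
Proof.
move=> xE Ey; apply: (@le_trans _ _ (2%:R `^ E%:R)); last by rewrite ler_powR// ler1n.
by rewrite powR_mulrn// -natrX ler_nat.
Qed.

(** 18 factors are enough to halve the error. *)
Lemma majority_error_le2 j : (24 / 25) ^+ (18 * j) <= 2 ^- j :> R.
Proof.
rewrite -exprVn exprM; apply: lerXn2r; rewrite ?nnegrE ?exprn_ge0 ?invr_ge0//; first lra.
have h6 : (24 / 25) ^+ 6 <= 783 / 1000 :> R by lra.
rewrite -[18%N]/(6 * 3)%N exprM; apply: (@le_trans _ _ ((783 / 1000) ^+ 3)); last by lra.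
by apply: lerXn2r h6; rewrite ?nnegrE ?exprn_ge0//; lra.
Qed.

End Asymptotics.

(** * Choice of the parameters *)

Lemma circuit_of_parameters (R : realType) n (F : formula n) (l k d r h : nat)
    (a b c x : R) :
  (0 < l)%N ->
  (forall A : formula n, (fsize A <= 2 * l + 2)%N ->
     has_prob_poly (feval A) x (1 / 3%:R)) ->
  x < d.+1%:R ->
  (forall g, (g * l <= 6 * fsize F + l)%N ->
     [/\ (264 * g <= k ^ 2)%N, g%:R * (24 / 25) ^+ r <= 1 / 16 :> R & (g < h)%N]) ->
  (1 + (125 * n) ^ (2 * r) * h ^ (2 * k))%:R <= a ->
  (n.+1 ^ (2 * r * d))%:R <= b -> (2 * r * d)%:R <= c ->
  sum_mod2_and a b c (feval F).
Proof.
move=> l0 probP xd gP ha hb hc.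
have n0 : (0 < n)%N.
  have i : 'I_n by clear -F; elim: F.
  exact: leq_ltn_trans (leq0n i) (ltn_ord i).
have [g gl [G [p [Gg pl FE]]]] := formula_decomposition F l0.
have [kg rg gh] := gP g gl.
have [P PP] : exists P : 'I_g -> 'I_(125 * n) -> poly2 n, forall i,
    (forall j, (pdeg (P i j))%:R <= x) /\
    forall y, (#|[set j | peval (P i j) y != feval (p i) y]| <= 50 * n)%N.
  apply: (@fin_all_exists _ (fun=> 'I_(125 * n) -> poly2 n) (fun i P =>
    (forall j, (pdeg (P j))%:R <= x) /\
    forall y, (#|[set j | peval (P j) y != feval (p i) y]| <= 50 * n)%N)) => i.
  by apply: prob_poly_sample => //; apply: probP.
have -> : feval F = fun y => feval G [ffun i => feval (p i) y].
  by apply/boolp.funext.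
apply: (@composed_circuit R n g (125 * n) r k d G (fun i => feval (p i)) P) => //.
- by rewrite muln_gt0.
- by rewrite Gg.
- by move=> i j; rewrite -ltnS -(ltr_nat R); apply: le_lt_trans ((PP i).1 j) xd.
- by move=> i y; have := (PP i).2 y; lia.
- apply: le_trans ha; rewrite ler_nat leq_add2l leq_mul2l; apply/orP; right.
  by case: (2 * k)%N => // e; rewrite leq_exp2r.
Qed.

Lemma succ_mul_expn_le x L i j : (x <= 2 ^ (2 * L))%N ->
  (1 + x ^ i * (2 ^ (2 * L)) ^ j <= 2 ^ (1 + 2 * L * i + 2 * L * j))%N.
Proof.
move=> xL; rewrite (expnD _ _ (2 * L * j)) (expnD _ 1) !(expnM 2 (2 * L)).
have y0 : (0 < 2 ^ (2 * L))%N by rewrite expn_gt0.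
move: (2 ^ (2 * L))%N y0 xL => y y0 xy.
have h1 : (0 < y ^ i * y ^ j)%N by rewrite muln_gt0 !expn_gt0 y0.
have h2 : (x ^ i * y ^ j <= y ^ i * y ^ j)%N.
  by rewrite leq_mul2r; apply/orP; right; case: i {h1} => // i; rewrite leq_exp2r.
by rewrite expn1 -mulnA mul2n -addnn leq_add.
Qed.

Lemma has_prob_poly_le (R : realType) n (f : cube n -> bool) (d d' eps : R) :
  d <= d' -> has_prob_poly f d eps -> has_prob_poly f d' eps.
Proof.
move=> dd [D [dD Dd Df]]; exists D; split=> // p /Dd pd; exact: le_trans pd dd.
Qed.

Lemma formula_circuit_exponent (R : realType) (delta alpha : R) :
  0 < delta < 1 -> 0 <= alpha -> (1 + alpha) * (1 - delta) < 1 ->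
  (forall (m : nat) (G : formula m),
     has_prob_poly (feval G) ((fsize G)%:R `^ (1 - delta)) (1 / 3%:R)) ->
  exists gamma : R, 0 < gamma /\
    forall C : R, exists n0 : nat, forall n : nat, (n0 <= n)%N ->
      forall F : formula n,
        (fsize F)%:R <= C * n%:R `^ (3%:R + alpha) ->
        sum_mod2_and (2%:R `^ (n%:R `^ (1 - gamma)))
                     (2%:R `^ (n%:R `^ (1 - gamma)))
                     (n%:R `^ (1 - gamma))
                     (feval F).
Proof.
move=> /andP[delta0 delta1] alpha0 ad probP.
(* Of the eight parts of the gap, six are spent on larger pieces, one on constants and logarithms,
   and one remains as [gamma]. *)
pose e := (1 - (1 + alpha) * (1 - delta)) / 8.
have e0 : 0 < e by rewrite /e; lra.
have eE : (1 + alpha) * (1 - delta) = 1 - 8 * e by rewrite /e; lra.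
have e8 : e < 1 / 8.
  have : 0 < (1 + alpha) * (1 - delta) by rewrite mulr_gt0//; lra.
  by lra.
exists e; split=> // C.
have e2 : 0 < 2 * e by lra.
have e6 : 0 < 6 * e by lra.
have e12 : 0 < 1 - 2 * e by lra.
have [n1 n1P] := powR_eventually_ge ((32 * 33) * (6 * `|C| + 1)) e2.
have [n2 n2P] := powR_eventually_ge (6 * `|C| + 2) e6.
have [n3 n3P] := up_log2_eventually_le (20 * (10 * 10)) e0.
have [n4 n4P] := powR_eventually_ge 2 e12.
exists (maxn 125 (maxn (maxn n1 n2) (maxn n3 n4))) => n; rewrite !geq_max.
move=> /and3P[n125 /andP[/n1P h1 /n2P h2] /andP[/n3P h3 /n4P h4]] F sF.
clear n1 n1P n2 n2P n3 n3P n4 n4P.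
pose N : R := n%:R; have N1 : 1 <= N by rewrite ler1n (leq_trans _ n125).
have N0 : 0 < N by lra.
set L := up_log 2 n in h3 *.
have nL : (n <= 2 ^ L)%N by apply: up_logP.
have L0 : (0 < L)%N by rewrite up_log_gt0 (leq_trans _ n125).
have n2L : (n ^ 2 <= 2 ^ (2 * L))%N by rewrite mulnC expnM leq_exp2r.
have n3L : (n ^ 3 <= 2 ^ (3 * L))%N by rewrite mulnC expnM leq_exp2r.
(* Up to constants, [u] is the size of a piece, [z] bounds the number of pieces, and [v] is the
   scale of both degrees. The factor [n^(2 e)] in [E2] absorbs the constants of
   [264 * g <= k ^ 2]. *)
pose v := N `^ (1 - 2 * e); pose u := N `^ (1 + alpha + 6 * e).
pose z := N `^ (2 - 6 * e).
rewrite -/N -/v in h1 h2 h3 h4 sF *.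
have u1 : 1 <= u by apply: powR_ge1 => //; lra.
have z1 : 1 <= z by apply: powR_ge1 => //; lra.
have v0 : 0 <= v by lra.
have E1 : N `^ (3%:R + alpha) = u * z.
  by rewrite -powR_add//; congr (_ `^ _); lra.
have E2 : v ^+ 2 = z * N `^ (2 * e).
  by rewrite expr2 -!powR_add//; congr (_ `^ _); lra.
have E3 : N ^+ 2 = z * N `^ (6 * e).
  by rewrite -powR_add// -powR_mulrn ?(ltW N0)//; congr (_ `^ _); lra.
have E4 : N `^ (1 - e) = v * N `^ e.
  by rewrite -powR_add//; congr (_ `^ _); lra.
have E5 : u `^ (1 - delta) <= v.
  by rewrite -powRrM ler_powR//; nra.
(* A piece has at most [2 * l + 2 <= 6 u] leaves, and [(6 u)^(1 - delta) <= 6 v]. *)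
pose l := (Num.truncn u).+1; pose k := Num.truncn v; pose d := Num.truncn (6 * v).
have /andP[lu ul] : u < l%:R <= u + 1.
  have /andP[ha hb] := truncn_itv (le_trans ler01 u1).
  by rewrite hb /l -natr1 lerD2r.
have /andP[kv vk] := truncn_itv v0; rewrite -/k in kv vk.
have /andP[dv vd] : d%:R <= 6 * v < d.+1%:R by apply: truncn_itv; lra.
(* [3 * L] halvings bring the majority error down to [n^-3], against [16 * g <= n^3]. *)
pose r := (18 * (3 * L))%N.
have gP g : (g * l <= 6 * fsize F + l)%N ->
    [/\ (264 * g <= k ^ 2)%N, g%:R * (24 / 25) ^+ r <= 1 / 16 :> R &
        (g < 2 ^ (2 * L))%N].
  rewrite -(ler_nat R) natrD !natrM => gl.
  have c0 := normr_ge0 C.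
  have sF' : (fsize F)%:R <= `|C| * z * l%:R.
    apply: le_trans sF _; rewrite E1.
    apply: (@le_trans _ _ (`|C| * (u * z))).
      by rewrite ler_wpM2r ?ler_norm// mulr_ge0; lra.
    by rewrite -mulrA ler_wpM2l// mulrC ler_wpM2l//; lra.
  have gz : g%:R <= 6 * `|C| * z + 1.
    have l0 : 0 < l%:R :> R by [].
    by rewrite -(ler_pM2r l0); lra.
  have cz : `|C| <= `|C| * z by rewrite ler_peMr.
  have gn : (g.+1 <= n ^ 2)%N.
    rewrite -(ler_nat R) natrX -/N E3 -natr1.
    apply: (@le_trans _ _ (z * (6 * `|C| + 2))); first by lra.
    by rewrite ler_wpM2l//; lra.
  split.
  - rewrite -[264%N]/(8 * 33)%N -(ler_nat R) natrX !natrM.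
    have kk : v ^+ 2 <= 4 * k%:R ^+ 2.
      have : v <= 2 * k%:R by rewrite -natr1 in vk; lra.
      by move=> h; rewrite -[4]/(4%:R : R); nra.
    have : z * ((32 * 33) * (6 * `|C| + 1)) <= v ^+ 2.
      by rewrite E2 ler_wpM2l//; lra.
    by lra.
  - apply: le_trans (ler_wpM2l (ler0n _ _) (majority_error_le2 R (3 * L))) _.
    rewrite -[2]/(2%:R : R) -natrX ler_pdivrMr ?ltr0n ?expn_gt0//.
    suff : (16 * g)%:R <= (2 ^ (3 * L))%:R :> R by rewrite natrM; lra.
    rewrite ler_nat; apply: leq_trans n3L; rewrite expnS leq_mul ?(ltnW gn)//.
    exact: leq_trans n125.
  - exact: leq_trans gn n2L.
(* All three bounds reduce to [O(L^2 v)], where [n^e] absorbs the constant and [L^2]. *)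
have bound t : t <= (20 * (10 * 10)) * L%:R ^+ 2 * v -> t <= N `^ (1 - e).
  by move=> h; apply: le_trans h _; rewrite E4 mulrC ler_wpM2l.
have L1 : 1 <= L%:R :> R by rewrite ler1n.
have LL : L%:R <= L%:R ^+ 2 :> R by rewrite expr2 ler_peMr//; lra.
have Lv : L%:R * v <= L%:R ^+ 2 * v by rewrite ler_wpM2r.
have LLv : L%:R ^+ 2 <= L%:R ^+ 2 * v by rewrite ler_peMr ?sqr_ge0//; lra.
apply: (@circuit_of_parameters R n F l k d r (2 ^ (2 * L)) _ _ _ (6 * v)) => //.
- move=> A As; apply: has_prob_poly_le (probP n A).
  have A6 : (fsize A)%:R <= 6 * u.
    have : (fsize A)%:R <= (2 * l + 2)%:R :> R by rewrite ler_nat.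
    by rewrite natrD natrM; lra.
  apply: (@le_trans _ _ ((6 * u) `^ (1 - delta))).
    by apply: ge0_ler_powR A6; rewrite ?nnegrE//; lra.
  rewrite powRM; [|by lra|by lra].
  apply: ler_pM; rewrite ?powR_ge0//.
  by apply: ler1_powR; lra.
(* The threshold [n >= 125] gives [125 * n <= n^2 <= 2^(2 * L)]. *)
- apply: (@natr_le_powR2 R _ (1 + 2 * L * (2 * r) + 2 * L * (2 * k))).
    apply: succ_mul_expn_le; apply: leq_trans n2L.
    by rewrite expnS expn1 leq_mul2r n125 orbT.
  apply: bound; rewrite !natrD !natrM.
  have kLv : L%:R * k%:R <= L%:R * v by rewrite ler_wpM2l.
  have v1 : 1 <= L%:R ^+ 2 * v by lra.
  by lra.
- apply: (@natr_le_powR2 R _ (2 * L * (2 * r * d))).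
    rewrite [leqRHS]expnM; case: (2 * r * d)%N => // t; rewrite leq_exp2r//.
    apply: leq_trans n2L; rewrite expnS expn1 -{1}[n]mul1n -addn1.
    by apply: (@leq_trans (2 * n)); rewrite ?leq_mul2r ?(leq_trans _ n125) ?orbT//
      mul2n -addnn mul1n leq_add2l (leq_trans _ n125).
  apply: bound; rewrite !natrM.
  have : L%:R ^+ 2 * d%:R <= L%:R ^+ 2 * (6 * v) by rewrite ler_wpM2l ?sqr_ge0.
  by have := mulr_ge0 (sqr_ge0 (L%:R : R)) v0; lra.
- apply: bound; rewrite !natrM.
  have : L%:R * d%:R <= L%:R * (6 * v) by rewrite ler_wpM2l.
  by have := mulr_ge0 (sqr_ge0 (L%:R : R)) v0; lra.
Qed.

Theorem theorem7 (R : realType) (delta : R) (delta_gt0 : 0 < delta)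
    (formula_prob_poly : forall (m : nat) (G : formula m),
       has_prob_poly (feval G) ((fsize G)%:R `^ (1 - delta)) (1 / 3%:R))
    (alpha : R) (alpha_lt : alpha < delta / (1 - delta)) :
  exists gamma : R, 0 < gamma /\
    forall C : R, exists n0 : nat, forall n : nat, (n0 <= n)%N ->
      forall F : formula n,
        (fsize F)%:R <= C * n%:R `^ (3%:R + alpha) ->
        sum_mod2_and (2%:R `^ (n%:R `^ (1 - gamma)))
                     (2%:R `^ (n%:R `^ (1 - gamma)))
                     (n%:R `^ (1 - gamma))
                     (feval F).
Proof.
(* Reduction to [0 < delta < 1] and [alpha >= 0]: raising [alpha] only admits larger formulas once
   [n >= 1]. *)
suff [d [a [d01 a0 ad aa dP]]] : exists d a : R,
    [/\ 0 < d < 1, 0 <= a, (1 + a) * (1 - d) < 1, alpha <= a &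
      forall (m : nat) (G : formula m),
        has_prob_poly (feval G) ((fsize G)%:R `^ (1 - d)) (1 / 3%:R)].
  have [gamma [gamma0 gP]] := formula_circuit_exponent d01 a0 ad dP.
  exists gamma; split=> // C; have [n0 n0P] := gP `|C|.
  exists n0.+1 => n nn F sF; apply: n0P; first exact: ltnW.
  apply: le_trans sF _.
  apply: le_trans (ler_wpM2r (powR_ge0 _ _) (ler_norm C)) _.
  by rewrite ler_wpM2l// ler_powR ?lerD2l// ler1n (leq_trans _ nn).
have [d1|d1] := ltrP delta 1.
  have d1' : 0 < 1 - delta by lra.
  exists delta, (Num.max alpha 0); split=> //.
  - by rewrite delta_gt0.
  - by rewrite le_max lexx orbT.
  - have : Num.max alpha 0 < delta / (1 - delta) by rewrite gt_max alpha_lt divr_gt0.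
    by rewrite ltr_pdivlMr//; lra.
  - by rewrite le_max lexx.
(* For [delta >= 1] the quotient [delta / (1 - delta)] is at most 0 (by convention 0 at
   [delta = 1]), so [alpha < 0]. Lowering [delta] to 1/2 only raises the allowed degree, as sizes
   are at least 1. *)
exists (1 / 2), 0; split=> [|||| m G]; try lra.
  apply/ltW/(lt_le_trans alpha_lt).
  by rewrite mulr_ge0_le0 ?invr_le0//; lra.
apply: has_prob_poly_le (formula_prob_poly m G).
by rewrite ler_powR ?ler1n ?fsize_gt0//; lra.
Qed.
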